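(* Let $\lambda_{ij}>0$ for all $i,j=1,\dots,k$, $i\ne j$. Let $(\chi,\psi)\in\mathscr F$ satisfy the following conditions, with $l_n,V_n,R_n$ corresponding to these $\lambda_{ij}$: (a) for any $r=1,2,\dots$, $I_{\{l_r^\chi<f_{\theta_1}^{r,\chi}+R_r^\chi\}}\le\psi_r^\chi\le I_{\{l_r^\chi\le f_{\theta_1}^{r,\chi}+R_r^\chi\}}$ $\mu^r$-almost everywhere on $C_r^{\psi,\chi}$; (b) for any $r=1,2,\dots$, $\int V_{r+1}^\chi(y^{(r+1)})\,d\mu(y_{r+1})=R_r^\chi(y^{(r)})$ $\mu^r$-almost everywhere on $\bar C_r^{\psi,\chi}$; (c) $\int V_1^\chi\,d\mu(y_1)=R_0$. Let $\phi$ be any decision rule satisfying $\phi_{nj}\le I_{\{\sum_{i\ne j}\lambda_{ij}f_{\theta_i}^n=l_n\}}$ for any $n=1,2,\dots$ and $j=1,\dots,k$. Then for any sequential testing procedure $(\chi',\psi',\phi')$ with $(\chi',\psi')\in\mathscr F$ such that $$\alpha_{ij}(\chi',\psi',\phi')\le\alpha_{ij}(\chi,\psi,\phi)\quad\text{for any } i,j=1,\dots,k,\ i\ne j,\qquad(1)$$ it holds $$N(\chi',\psi')\ge N(\chi,\psi).\qquad(2)$$ The inequality in (2) is strict if at least one of the inequalities in (1) is strict. If there are equalities in all of the inequalities in (1) and (2), then $(\chi',\psi')$ satisfies conditions (a), (b), (c) as well (with $\chi'$ instead of $\chi$ and $\psi'$ instead of $\psi$).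
   Context: Model. There are $k\ge 2$ simple hypotheses $H_i:\theta=\theta_i$, $i=1,\dots,k$. A control variable takes values in a measurable space $\mathcal X$; observations take values in a measurable space $\mathcal Y$ with a $\sigma$-finite measure $\mu$. Under parameter $\theta$ and control $x$, an observation has density $f_\theta(y|x)$ with respect to $\mu$. Given controls $x_1,\dots,x_n$, the observations are independent, with joint density $f_\theta^n=f_\theta^n(x^{(n)},y^{(n)})=\prod_{i=1}^n f_\theta(y_i|x_i)$ with respect to $\mu^n=\mu\otimes\cdots\otimes\mu$. Here $x^{(n)}=(x_1,\dots,x_n)$, $y^{(n)}=(y_1,\dots,y_n)$. Procedures. A sequential testing procedure is a triplet $(\chi,\psi,\phi)$: a control policy $\chi=(\chi_1,\chi_2,\dots)$ of measurable functions $\chi_n=\chi_n(x^{(n-1)},y^{(n-1)})$ with values in $\mathcal X$ ($\chi_1$ is a fixed element of $\mathcal X$); a stopping rule $\psi=(\psi_1,\psi_2,\dots)$ of measurable functions $\psi_n=\psi_n(x^{(n)},y^{(n)})\in[0,1]$ (conditional probability of stopping at stage $n$ given that stage $n$ is reached); and a decision rule $\phi=(\phi_1,\phi_2,\dots)$, $\phi_n=(\phi_{n1},\dots,\phi_{nk})$, of measurable functions $\phi_{nj}=\phi_{nj}(x^{(n)},y^{(n)})\ge0$ with $\sum_{j=1}^k\phi_{nj}\equiv1$ (conditional probability of accepting $H_j$ when stopping at stage $n$). At each stage the control $x_n=\chi_n(x^{(n-1)},y^{(n-1)})$ is applied and then $y_n$ is observed. A pair $(\chi,\psi)$ is called a strategy.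 Notation. For $F_n=F_n(x^{(n)},y^{(n)})$, $F_n^\chi(y^{(n)})$ denotes $F_n(x^{(n)},y^{(n)})$ with $x_i=\chi_i(x^{(i-1)},y^{(i-1)})$, $i=1,\dots,n$; $f_\theta^{n,\chi}$ is the density of $Y^{(n)}$ under $\theta$ and $\chi$, and $E_\theta^\chi F_n=\int F_n^\chi f_\theta^{n,\chi}d\mu^n$. $I_A$ is the indicator of $A$. The stopping time $\tau_\psi$ satisfies $P_\theta^\chi(\tau_\psi=n)=E_\theta^\chi(1-\psi_1)\cdots(1-\psi_{n-1})\psi_n$. $C_n^{\psi,\chi}=\{y^{(n)}:(1-\psi_1^\chi(y^{(1)}))\cdots(1-\psi_{n-1}^\chi(y^{(n-1)}))>0\}$ for $n\ge2$, $C_1^{\psi,\chi}$ is the whole space of $y^{(1)}$, and $\bar C_n^{\psi,\chi}=\{y^{(n)}:(1-\psi_1^\chi(y^{(1)}))\cdots(1-\psi_n^\chi(y^{(n)}))>0\}$ for $n\ge1$. Characteristics. $\alpha_{ij}(\chi,\psi,\phi)=\sum_{n=1}^\infty E_{\theta_i}^\chi(1-\psi_1)\cdots(1-\psi_{n-1})\psi_n\phi_{nj}$ (probability of accepting $H_j$ under $\theta_i$). $N(\chi,\psi)=E_{\theta_1}^\chi\tau_\psi=\sum_{n\ge1}nP_{\theta_1}^\chi(\tau_\psi=n)$ if $P_{\theta_1}^\chi(\tau_\psi<\infty)=1$, and $\infty$ otherwise. Class. $\mathscr F$ is the set of all strategies $(\chi,\psi)$ with $\lim_{n\to\infty}E_{\theta_i}^\chi(1-\psi_1)\cdots(1-\psi_n)=0$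 for every $i=1,\dots,k$ (equivalently, $P_{\theta_i}^\chi(\tau_\psi<\infty)=1$ for all $i$). Functions $l_n,V_n,R_n$. $l_n=\min_{1\le j\le k}\sum_{i\ne j}\lambda_{ij}f_{\theta_i}^n$. For $N\ge1$ let $V_N^N=l_N$ and, recursively for $n=N,N-1,\dots,2$, $V_{n-1}^N=\min\{l_{n-1},f_{\theta_1}^{n-1}+R_{n-1}^N\}$ with $R_{n-1}^N(x^{(n-1)},y^{(n-1)})=\min_{x_n}\int V_n^N(x^{(n)},y^{(n)})d\mu(y_n)$. The sequence $V_n^N$ is non-increasing in $N$; $V_n=\lim_{N\to\infty}V_n^N$, $R_n(x^{(n)},y^{(n)})=\min_{x_{n+1}}\int V_{n+1}(x^{(n+1)},y^{(n+1)})d\mu(y_{n+1})$ for $n\ge1$, and $R_0=\min_{x_1}\int V_1(x_1,y_1)d\mu(y_1)$. Standing assumption: all these functions defined by minima over the control are well-defined (minima attained) and measurable. *)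

(* Defs.v *)
From HB Require Import structures.
From mathcomp Require Import all_boot all_order all_algebra.
From mathcomp Require Import all_classical all_reals all_analysis.
From mathcomp Require Import measurable_realfun.
Set Implicit Arguments.
Unset Strict Implicit.
Unset Printing Implicit Defensive.
Import Order.TTheory GRing.Theory Num.Theory.
Import numFieldNormedType.Exports.
Local Open Scope classical_set_scope.
Local Open Scope ring_scope.
Local Open Scope ereal_scope.

Definition rconst T n (t : n.-tuple T) (a : T) : n.+1.-tuple T :=
  [tuple of rcons t a].

(* t^(m) = (t_1, ..., t_m), as a prefix of t = t^(n) *)
Definition prefixt T m n (h : (m <= n)%N) (t : n.-tuple T) : m.-tuple T :=
  [tuple tnth t (widen_ord h i) | i < m].

Section power_measure.
Context d (R : realType) (Y : measurableType d).

Definition rconsp n (p : n.-tuple Y * Y) : n.+1.-tuple Y := rconst p.1 p.2.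

Lemma measurable_rconsp n : measurable_fun [set: n.-tuple Y * Y] (@rconsp n).
Proof.
apply/measurable_fun_tnthP => i /=.
have [lin|lni] := ltnP i n.
- rewrite (_ : _ \o _ = (fun t : n.-tuple Y => tnth t (Ordinal lin)) \o fst).
    exact: measurableT_comp (measurable_tnth _) measurable_fst.
  apply/funext => p /=.
  by rewrite /rconsp /rconst !(tnth_nth p.2) /= nth_rcons size_tuple lin.
- rewrite (_ : _ \o _ = snd); first exact: measurable_snd.
  apply/funext => p /=.
  rewrite /rconsp /rconst (tnth_nth p.2) /= nth_rcons size_tuple.
  have -> : (i : nat) = n by apply/eqP; rewrite eqn_leq lni -ltnS ltn_ord.
  by rewrite ltnn eqxx.
Qed.

Section step.
Variables (n : nat) (nu : {measure set (n.-tuple Y) -> \bar R}).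
Variable mu : {sigma_finite_measure set Y -> \bar R}.

Definition power_step : set (n.+1.-tuple Y) -> \bar R :=
  pushforward (nu \x mu) (@rconsp n).

Let mrconsp := @measurable_rconsp n.

Let power_step0 : power_step set0 = 0.
Proof. exact: measure0. Qed.

Let power_step_ge0 A : 0 <= power_step A.
Proof. exact: measure_ge0. Qed.

Let power_step_sigma_additive : semi_sigma_additive power_step.
Proof. exact: measure_semi_sigma_additive. Qed.

HB.instance Definition _ := isMeasure.Build _ _ _ power_step
  power_step0 power_step_ge0 power_step_sigma_additive.

End step.

(* mu^n = mu \x ... \x mu, transported to Y^n = n.-tuple Y *)
Fixpoint power_measure (mu : {sigma_finite_measure set Y -> \bar R}) n :
    {measure set (n.-tuple Y) -> \bar R} :=
  match n with
  | 0 => \d_[tuple]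
  | m.+1 => power_step (power_measure mu m) mu
  end.

End power_measure.

Section sequential_testing.
Context (R : realType) (dX dY : measure_display).
Context (X : measurableType dX) (Y : measurableType dY).
Context (mu : {sigma_finite_measure set Y -> \bar R}).
Context (k : nat) (hk : (1 < k)%N).

(* hypotheses are indexed by 'I_k; H1 is the index of theta_1 *)
Definition H1 : 'I_k := Ordinal (ltnW hk).

Local Notation jointly_measurable n F :=
  (measurable_fun [set: n.-tuple X * n.-tuple Y] (fun h => F h.1 h.2)).

(* f i x y = f_{theta_i}(y | x) *)
Definition is_density_family (f : 'I_k -> X -> Y -> R) :=
  forall i, [/\ measurable_fun [set: X * Y] (fun p => f i p.1 p.2),
    forall x y, (0 <= f i x y)%R &
    forall x, \int[mu]_y (f i x y)%:E = 1].

(* [chi n] is chi_{n+1}, a function of the first n controls and observations *)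
Definition policy := forall n, n.-tuple X -> n.-tuple Y -> X.
(* [psi n] is psi_n; the value at n = 0 is never used (same for decisions) *)
Definition stopping := forall n, n.-tuple X -> n.-tuple Y -> R.
Definition decision := forall n, 'I_k -> n.-tuple X -> n.-tuple Y -> R.

Definition is_policy (chi : policy) := forall n, jointly_measurable n (@chi n).

Definition is_stopping (psi : stopping) := forall n, (0 < n)%N ->
  jointly_measurable n (@psi n) /\ forall x y, (0 <= psi n x y <= 1)%R.

Definition is_decision (phi : decision) := forall n, (0 < n)%N ->
  [/\ forall j, jointly_measurable n (phi n j),
    forall j x y, (0 <= phi n j x y)%R &
    forall x y, (\sum_(j < k) phi n j x y = 1)%R].

(* the controls x_1, ..., x_n that chi generates along y_1, ..., y_n *)
Fixpoint controls (chi : policy) n : n.-tuple Y -> n.-tuple X :=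
  match n with
  | 0 => fun=> [tuple]
  | m.+1 => fun y =>
      let y' := prefixt (leqnSn m) y in
      let x' := controls chi y' in rconst x' (chi m x' y')
  end.

(* F_n^chi *)
Definition along (chi : policy) n T (F : n.-tuple X -> n.-tuple Y -> T) :
    n.-tuple Y -> T :=
  fun y => F (controls chi y) y.

Section densities.
Variable f : 'I_k -> X -> Y -> R.

Definition joint_density i n (x : n.-tuple X) (y : n.-tuple Y) : R :=
  (\prod_(m < n) f i (tnth x m) (tnth y m))%R.

Definition expect (chi : policy) i n (F : n.-tuple X -> n.-tuple Y -> R) :
    \bar R :=
  \int[power_measure mu n]_y
    (along chi F y * along chi (joint_density i (n:=n)) y)%:E.

(* (1 - psi_1) ... (1 - psi_{n-1}); the factor of index m is 1 - psi_{m+1} *)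
Definition reach (psi : stopping) n (x : n.-tuple X) (y : n.-tuple Y) : R :=
  (\prod_(m < n | (m.+1 < n)%N)
     (1 - psi m.+1 (prefixt (ltn_ord m) x) (prefixt (ltn_ord m) y)))%R.

(* (1 - psi_1) ... (1 - psi_n) *)
Definition survive (psi : stopping) n (x : n.-tuple X) (y : n.-tuple Y) : R :=
  (\prod_(m < n)
     (1 - psi m.+1 (prefixt (ltn_ord m) x) (prefixt (ltn_ord m) y)))%R.

(* C_n^{psi,chi} and \bar C_n^{psi,chi} *)
Definition reach_set (chi : policy) (psi : stopping) n : set (n.-tuple Y) :=
  [set y | (0 < along chi (reach psi (n:=n)) y)%R].

Definition survive_set (chi : policy) (psi : stopping) n : set (n.-tuple Y) :=
  [set y | (0 < along chi (survive psi (n:=n)) y)%R].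

(* P_{theta_i}^chi (tau_psi = n) *)
Definition stop_at (chi : policy) (psi : stopping) i n : \bar R :=
  expect chi i (fun x y => reach psi x y * psi n x y)%R.

Definition alpha (chi : policy) (psi : stopping) (phi : decision) i j : \bar R :=
  \sum_(1 <= n <oo)
    expect chi i (fun x y => reach psi x y * psi n x y * phi n j x y)%R.

Definition avg_sample_number (chi : policy) (psi : stopping) : \bar R :=
  if \sum_(1 <= n <oo) stop_at chi psi H1 n == 1
  then \sum_(1 <= n <oo) n%:R%:E * stop_at chi psi H1 n
  else +oo.

Definition strategy_class (chi : policy) (psi : stopping) :=
  [/\ is_policy chi, is_stopping psi &
    forall i, expect chi i (survive psi (n:=n)) @[n --> \oo] --> 0].

Section weights.
Variable lam : 'I_k -> 'I_k -> R.

Definition accept_loss j n (x : n.-tuple X) (y : n.-tuple Y) : R :=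
  (\sum_(i < k | i != j) lam i j * joint_density i x y)%R.

(* l_n *)
Definition min_loss n (x : n.-tuple X) (y : n.-tuple Y) : \bar R :=
  \big[Order.min/+oo]_(j < k) (accept_loss j x y)%:E.

Definition next_cost n (G : n.+1.-tuple X -> n.+1.-tuple Y -> \bar R)
    (x : n.-tuple X) (y : n.-tuple Y) (u : X) : \bar R :=
  \int[mu]_z G (rconst x u) (rconst y z).

(* min over x_{n+1} of \int G(x^(n+1), y^(n+1)) dmu(y_{n+1}); that the infimum
   is a minimum is part of [min_control_ok] *)
Definition min_control n (G : n.+1.-tuple X -> n.+1.-tuple Y -> \bar R)
    (x : n.-tuple X) (y : n.-tuple Y) : \bar R :=
  ereal_inf (range (next_cost G x y)).

Definition min_control_ok n (G : n.+1.-tuple X -> n.+1.-tuple Y -> \bar R) :=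
  (forall x y, exists u, next_cost G x y u = min_control G x y) /\
  jointly_measurable n (min_control G).

(* backward p n = V_n^{n+p} *)
Fixpoint backward p n : n.-tuple X -> n.-tuple Y -> \bar R :=
  match p with
  | 0 => min_loss (n:=n)
  | q.+1 => fun x y => Order.min (min_loss x y)
      ((joint_density H1 x y)%:E + min_control (@backward q n.+1) x y)
  end.

(* V_n^N, meaningful for n <= N *)
Definition VN N n : n.-tuple X -> n.-tuple Y -> \bar R := @backward (N - n) n.

Definition RN N n : n.-tuple X -> n.-tuple Y -> \bar R :=
  min_control (@VN N n.+1).

Lemma VN_last N : @VN N N = min_loss (n:=N).
Proof. by rewrite /VN subnn. Qed.

Lemma VN_rec N n x y : (n < N)%N ->
  @VN N n x y =
  Order.min (min_loss x y) ((joint_density H1 x y)%:E + RN N x y).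
Proof. by move=> nN; rewrite /RN /VN -(subnSK nN). Qed.

Definition V n (x : n.-tuple X) (y : n.-tuple Y) : \bar R :=
  limn (fun N => VN N x y).

(* R_n for all n >= 0; R_0 is its value at the empty tuples *)
Definition Rn n : n.-tuple X -> n.-tuple Y -> \bar R := min_control (@V n.+1).

(* the standing assumption on the minima over controls *)
Definition minima_ok :=
  (forall N n, (0 < n < N)%N -> min_control_ok (@VN N n.+1)) /\
  (forall n, min_control_ok (@V n.+1)).

Definition cond_a (chi : policy) (psi : stopping) :=
  forall r, (0 < r)%N ->
  let lr := along chi (min_loss (n:=r)) in
  let cr := fun y => (along chi (joint_density H1 (n:=r)) y)%:E
                     + along chi (@Rn r) y in
  {ae power_measure mu r, forall y, reach_set chi psi y ->
    (\1_[set y' | (lr y' < cr y')%E] y <= along chi (psi r) y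
       <= \1_[set y' | (lr y' <= cr y')%E] y)%R}.

Definition cond_b (chi : policy) (psi : stopping) :=
  forall r, (0 < r)%N ->
  {ae power_measure mu r, forall y, survive_set chi psi y ->
    \int[mu]_z along chi (@V r.+1) (rconst y z) = along chi (@Rn r) y}.

Definition cond_c (chi : policy) :=
  \int[mu]_z along chi (@V 1) [tuple z] = Rn [tuple] [tuple].

Definition optimal_conditions (chi : policy) (psi : stopping) :=
  [/\ cond_a chi psi, cond_b chi psi & cond_c chi].

Definition minimizing_decision (phi : decision) :=
  forall n, (0 < n)%N -> forall j x y,
  (phi n j x y <=
    \1_[set h : n.-tuple X * n.-tuple Y |
         (accept_loss j h.1 h.2)%:E = min_loss h.1 h.2] (x, y))%R.

End weights.
End densities.
End sequential_testing.

(* Main.v *)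
Require Import Defs.
From HB Require Import structures.
From mathcomp Require Import all_boot all_order all_algebra.
From mathcomp Require Import all_classical all_reals all_analysis.
From mathcomp Require Import measurable_realfun ring lra.
Set Implicit Arguments.
Unset Strict Implicit.
Unset Printing Implicit Defensive.
Import Order.TTheory GRing.Theory Num.Theory.
Import numFieldNormedType.Exports.
Local Open Scope classical_set_scope.
Local Open Scope ring_scope.
Local Open Scope ereal_scope.

(* By Lagrange multipliers, it suffices to minimise the Bayes risk N + sum_(i <> j)
   lambda_ij alpha_ij, which is finite for the given procedure. Choosing phi
   bounds the error term below by the sum of the expected values of l_n at the
   stopping time, and N is 1 plus the sum of the survival probabilities under
   theta_1. Write a_n for the integral of (1 - psi_1) ... (1 - psi_(n-1)) V_n^chi.
   From V_n = min (l_n, f_1^n + R_n) and R_n <= int V_(n+1)^chi one gets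
   a_n <= (cost of stage n) + a_(n+1); as a_n is dominated by survival
   probabilities it tends to 0 in the class F, so the Bayes risk is at least
   1 + a_1 >= 1 + R_0. Equality in all these finite integrals is equality almost
   everywhere of the integrands, which is (a), (b), (c). *)

(** Since the densities are factors of l_n, every loss is integrated against the same measure mu^n,
    and the losses under all hypotheses can be compared pointwise along one path of observations.
    The recursion V_n = min (l_n, f_1^n + R_n) holds by definition only for the finite-horizon
    V_n^N; for the limits it has to be proved, because the limit in N must cross both an integral
    and a minimum over controls ([V_rec]). The passage from a_n to a_(n+1) is cut in two by
    [value_after]: one inequality concerns stopping or continuing at stage n, the other the choice
    of the next control. Their equality cases are (a) and (b) separately, (c) being the case before
    any observation. All sums live in [\bar R], where N(chi', psi') may be infinite. The argument
    therefore rests on the finiteness of R_0, of every a_n and of the error terms: it licenses each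
    cancellation and lets equality of sums split into equality of terms. The constant 1 in the risk
    is the cost of the first observation, which no stopping rule avoids. *)

Section tuples.
Context {T : Type}.

Lemma tnth_rconst_widen n (t : n.-tuple T) a (i : 'I_n.+1) (lt_in : (i < n)%N) :
  tnth (rconst t a) i = tnth t (Ordinal lt_in).
Proof. by rewrite !(tnth_nth a) /= nth_rcons size_tuple lt_in. Qed.

Lemma tnth_rconst_last n (t : n.-tuple T) a (i : 'I_n.+1) :
  i = n :> nat -> tnth (rconst t a) i = a.
Proof. by move=> iE; rewrite (tnth_nth a) /= nth_rcons size_tuple iE ltnn eqxx. Qed.

Lemma prefixt_rconst m n (hm : (m <= n.+1)%N) (hmn : (m <= n)%N)
    (t : n.-tuple T) a :
  prefixt hm (rconst t a) = prefixt hmn t.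
Proof.
apply/eq_from_tnth => i; rewrite !tnth_mktuple.
have lt_in : (widen_ord hm i < n)%N by exact: leq_trans (ltn_ord i) hmn.
by rewrite (tnth_rconst_widen _ _ lt_in); congr tnth; exact/val_inj.
Qed.

Lemma prefixt_id n (h : (n <= n)%N) (t : n.-tuple T) : prefixt h t = t.
Proof.
by apply/eq_from_tnth => i; rewrite tnth_mktuple; congr tnth; exact/val_inj.
Qed.

Lemma rconst_prefixt n (h : (n <= n.+1)%N) (t : n.+1.-tuple T) :
  rconst (prefixt h t) (tnth t ord_max) = t.
Proof.
apply/eq_from_tnth => i; have [lt_in|] := ltnP i n.
  rewrite (tnth_rconst_widen _ _ lt_in) tnth_mktuple; congr tnth.
  exact/val_inj.
move=> le_ni; have iE : i = n :> nat.
  by apply/eqP; rewrite eqn_leq le_ni -ltnS ltn_ord.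
by rewrite tnth_rconst_last//; congr tnth; exact/val_inj.
Qed.

End tuples.

Lemma measurable_prefixt d (T : measurableType d) m n (h : (m <= n)%N) :
  measurable_fun [set: n.-tuple T] (@prefixt T m n h).
Proof.
apply/measurable_fun_tnthP => i.
rewrite (_ : _ \o _ = fun t : n.-tuple T => tnth t (widen_ord h i)).
  exact: measurable_tnth.
by apply/funext => t /=; rewrite tnth_mktuple.
Qed.

Lemma measurable_rconst d0 (S : measurableType d0) d (T : measurableType d) n
    (f : S -> n.-tuple T) (g : S -> T) :
  measurable_fun [set: S] f -> measurable_fun [set: S] g ->
  measurable_fun [set: S] (fun s => rconst (f s) (g s)).
Proof.
move=> mf mg.
rewrite (_ : (fun s => _) = @rconsp _ T n \o (fun s => (f s, g s)))//.
apply: measurableT_comp; first exact: measurable_rconsp.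
exact: measurable_fun_pair.
Qed.

(** Meant for the sums over [i != j] in the losses: terms outside the filter are replaced by 0, and
    the unfiltered case applies. *)
Lemma ge0_integral_sum_cond d (T : measurableType d) (R : realType)
    (nu : {measure set T -> \bar R}) (I : Type) (s : seq I) (P : pred I)
    (g : I -> T -> \bar R) :
  (forall i, P i -> measurable_fun setT (g i)) ->
  (forall i x, P i -> 0 <= g i x) ->
  \int[nu]_x (\sum_(i <- s | P i) g i x) = \sum_(i <- s | P i) \int[nu]_x g i x.
Proof.
move=> mg g0; pose h i x := if P i then g i x else 0.
transitivity (\int[nu]_x \sum_(i <- s) h i x).
  by apply: eq_integral => x _; rewrite big_mkcond.
rewrite ge0_integral_sum//.
- rewrite [RHS]big_mkcond; apply: eq_bigr => i _; rewrite /h.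
  by case: (P i) => //; rewrite integral0.
- by move=> i; rewrite /h; case: (boolP (P i)) => // /mg.
- by move=> i x _; rewrite /h; case: (boolP (P i)) => // /g0.
Qed.

(** * Product measures on tuples: sigma-finiteness and Tonelli *)

Section power_measure_theory.
Context d (R : realType) (Y : measurableType d).
Variable mu : {sigma_finite_measure set Y -> \bar R}.

(** Appending a coordinate has the measurable left inverse [unrcons], so rectangles pull back to
    sets of the product mass. Both exhausting sequences are taken non-decreasing, so that the
    diagonal rectangles [F i] x [G i] already cover the space. *)
Lemma sigma_finite_power_step n (nu : {measure set (n.-tuple Y) -> \bar R}) :
  sigma_finite setT nu -> sigma_finite setT (power_step nu mu).
Proof.
move=> /sigma_finiteP[F [TF ndF Foo]].
have /sigma_finiteP[G [TG ndG Goo]] := sigma_finiteT mu.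
pose unrcons (t : n.+1.-tuple Y) := (prefixt (leqnSn n) t, tnth t ord_max).
have munrcons : measurable_fun setT unrcons.
  apply: measurable_fun_pair; last exact: measurable_tnth.
  exact: measurable_prefixt.
have rconspK : cancel (@rconsp _ Y n) unrcons.
  move=> [t a]; rewrite /unrcons /rconsp/= tnth_rconst_last//.
  by rewrite (prefixt_rconst _ (leqnn n)) prefixt_id.
exists (fun i => unrcons @^-1` (F i `*` G i)).
  rewrite -preimage_bigcup -[LHS](preimage_setT unrcons) -setXTT TF TG.
  congr preimage; apply/seteqP; split => [[y z] /=|[y z] [m _ []/= ? ?]].
    move=> [/= [m _ Fmy] [p _ Gpz]]; exists (maxn m p) => //; split.
    - by move: y Fmy; exact/subsetPset/ndF/leq_maxl.
    - by move: z Gpz; exact/subsetPset/ndG/leq_maxr.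
  by split; exists m.
move=> i; have [mFi Fi_fin] := Foo i; have [mGi Gi_fin] := Goo i; split.
  by rewrite -[X in measurable X]setTI; apply: munrcons => //; exact: measurableX.
rewrite /power_step /pushforward -comp_preimage.
rewrite (_ : _ \o _ = id); last exact/funext.
rewrite preimage_id product_measure1E//.
by rewrite lte_mul_pinfty// ge0_fin_numE.
Qed.

Lemma sigma_finite_power_measure n : sigma_finite setT (power_measure mu n).
Proof.
elim: n => [|n IHn] /=; last exact: sigma_finite_power_step.
exact: sigma_finiteT.
Qed.

Section tonelli.
Variables (n : nat) (g : n.+1.-tuple Y -> \bar R).
Hypotheses (g0 : forall y, 0 <= g y) (mg : measurable_fun setT g).

(** [power_measure] carries only a measure structure; Tonelli is applied to the bundle [nu], which
    adds the sigma-finiteness proved above to the same function. *)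
Let sf := isSigmaFinite.Build _ _ _ (Measure.sort (power_measure mu n))
  (sigma_finite_power_measure n).
Let nu : {sigma_finite_measure set (n.-tuple Y) -> \bar R} :=
  HB.pack_for (sigma_finite_measure (n.-tuple Y) R)
    (Measure.sort (power_measure mu n)) sf
   (isSFinite.Build _ _ _ (Measure.sort (power_measure mu n))
     (sfinite_measure_sigma_finite (sigma_finite_power_measure n))).

Let mgr : measurable_fun setT (g \o @rconsp _ Y n).
Proof. exact: measurableT_comp (@measurable_rconsp _ _ n). Qed.

Lemma integral_power_measureS :
  \int[power_measure mu n.+1]_y g y =
  \int[power_measure mu n]_y \int[mu]_z g (rconst y z).
Proof.
rewrite /= /power_step (ge0_integral_pushforward (@measurable_rconsp _ _ n)) //.
rewrite preimage_setT.
exact: (@fubini_tonelli1 _ _ _ _ R nu mu _ mgr (fun=> g0 _)).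
Qed.

Lemma measurable_integral_rconst :
  measurable_fun setT (fun y => \int[mu]_z g (rconst y z)).
Proof.
exact: (@measurable_fun_fubini_tonelli_F _ _ _ _ R mu _ mgr (fun=> g0 _)).
Qed.

End tonelli.

Lemma integral_power_measure1 (g : 1.-tuple Y -> \bar R) :
  (forall y, 0 <= g y) -> measurable_fun setT g ->
  \int[power_measure mu 1]_y g y = \int[mu]_z g [tuple z].
Proof.
move=> g0 mg; rewrite integral_power_measureS//= integral_dirac//.
- rewrite diracT mul1e; apply: eq_integral => z _; congr g.
  exact/val_inj.
- exact: measurable_integral_rconst.
Qed.

End power_measure_theory.

Local Notation jointly_measurable n F :=
  (measurable_fun [set: n.-tuple _ * n.-tuple _] (fun h => F h.1 h.2)).

Lemma measurable_fun_comp2 d0 (S : measurableType d0) d1 (T1 : measurableType d1)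
    d2 (T2 : measurableType d2) d3 (T3 : measurableType d3)
    (F : T1 -> T2 -> T3) (a : S -> T1) (b : S -> T2) :
  measurable_fun [set: T1 * T2] (fun h => F h.1 h.2) ->
  measurable_fun setT a -> measurable_fun setT b ->
  measurable_fun setT (fun s => F (a s) (b s)).
Proof.
move=> mF ma mb.
rewrite (_ : (fun s => _) = (fun h => F h.1 h.2) \o (fun s => (a s, b s)))//.
exact/(measurableT_comp mF)/measurable_fun_pair.
Qed.

(** * Control paths, reaching and surviving a stage *)

Section processes.
Context (R : realType) (dX dY : measure_display).
Context (X : measurableType dX) (Y : measurableType dY).
Implicit Types (chi : policy X Y) (psi : stopping R X Y).

Lemma controls_rconst chi n (y : n.-tuple Y) z :
  controls chi (rconst y z) =
  rconst (controls chi y) (chi n (controls chi y) y).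
Proof. by rewrite /= (prefixt_rconst _ (leqnn n)) prefixt_id. Qed.

Lemma measurable_controls chi n : is_policy chi ->
  measurable_fun setT (@controls _ _ X Y chi n).
Proof.
move=> chiP; elim: n => [|n IHn]; first by apply/measurable_fun_tnthP; case.
have mp : measurable_fun setT (fun y : n.+1.-tuple Y =>
    controls chi (prefixt (leqnSn n) y)).
  exact: (measurableT_comp IHn (measurable_prefixt (leqnSn n))).
apply: measurable_rconst => //.
by apply: (measurable_fun_comp2 (chiP n)) => //; exact: measurable_prefixt.
Qed.

Lemma measurable_along chi n d (T : measurableType d)
    (F : n.-tuple X -> n.-tuple Y -> T) :
  is_policy chi -> jointly_measurable n F -> measurable_fun setT (along chi F).
Proof.
by move=> chiP mF; apply: measurable_fun_comp2 => //; exact: measurable_controls.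
Qed.

Lemma surviveS psi n (x : n.-tuple X) u (y : n.-tuple Y) z :
  survive psi (rconst x u) (rconst y z) =
  (survive psi x y * (1 - psi n.+1 (rconst x u) (rconst y z)))%R.
Proof.
rewrite /survive big_ord_recr /= !prefixt_id; congr (_ * _)%R.
apply: eq_bigr => i _; congr (1 - psi _ _ _)%R; exact: prefixt_rconst.
Qed.

(** At length n + 1 the filter in [reach] discards only the index n, that is, the factor 1 -
    psi_(n+1). Hence reaching stage n + 1 is surviving the first n stages, and the last coordinate
    does not enter. *)
Lemma reachS psi n (x : n.+1.-tuple X) (y : n.+1.-tuple Y) :
  reach psi x y =
  survive psi (prefixt (leqnSn n) x) (prefixt (leqnSn n) y).
Proof.
rewrite -[x in LHS](rconst_prefixt (leqnSn n)).
rewrite -[y in LHS](rconst_prefixt (leqnSn n)).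
rewrite /reach big_mkcond big_ord_recr /= ltnn mulr1.
apply: eq_bigr => i _; rewrite ltnS ltn_ord.
congr (1 - psi _ _ _)%R; exact: prefixt_rconst.
Qed.

Lemma reach_rconst psi n (x : n.-tuple X) u (y : n.-tuple Y) z :
  reach psi (rconst x u) (rconst y z) = survive psi x y.
Proof. by rewrite reachS !(prefixt_rconst _ (leqnn n)) !prefixt_id. Qed.

Lemma survive_reach psi n (x : n.+1.-tuple X) (y : n.+1.-tuple Y) :
  survive psi x y = (reach psi x y * (1 - psi n.+1 x y))%R.
Proof.
rewrite -[x](rconst_prefixt (leqnSn n)) -[y](rconst_prefixt (leqnSn n)).
by rewrite surviveS reach_rconst.
Qed.

Lemma survive_itv psi n (x : n.-tuple X) (y : n.-tuple Y) :
  is_stopping psi -> (0 <= survive psi x y <= 1)%R.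
Proof.
move=> psiP; rewrite /survive prodr_ge0 => [|i _]; last first.
  by have [_ /(_ (prefixt (ltn_ord i) x) (prefixt (ltn_ord i) y))] :=
    psiP i.+1 isT; rewrite subr_ge0 => /andP[].
apply: prodr_ile1 => i _.
have [_ /(_ (prefixt (ltn_ord i) x) (prefixt (ltn_ord i) y))/andP[p0 p1]] :=
    psiP i.+1 isT.
by rewrite subr_ge0 p1/= gerBl.
Qed.

Lemma survive_ge0 psi n (x : n.-tuple X) (y : n.-tuple Y) :
  is_stopping psi -> (0 <= survive psi x y)%R.
Proof. by move=> /(survive_itv x y)/andP[]. Qed.

Lemma reach_ge0 psi n (x : n.+1.-tuple X) (y : n.+1.-tuple Y) :
  is_stopping psi -> (0 <= reach psi x y)%R.
Proof. by move=> psiP; rewrite reachS survive_ge0. Qed.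

Lemma measurable_survive psi n : is_stopping psi ->
  jointly_measurable n (@survive _ _ _ X Y psi n).
Proof.
move=> psiP; apply: measurable_prod => i _; apply: measurable_funB => //.
have [mpsi _] := psiP i.+1 isT.
apply: (measurable_fun_comp2 mpsi).
- exact: (measurableT_comp (measurable_prefixt _)).
- exact: (measurableT_comp (measurable_prefixt _)).
Qed.

Lemma measurable_reach psi n : is_stopping psi ->
  jointly_measurable n.+1 (@reach _ _ _ X Y psi n.+1).
Proof.
move=> psiP; under eq_fun do rewrite reachS.
apply: (measurable_fun_comp2 (measurable_survive psiP)).
- exact: (measurableT_comp (measurable_prefixt _)).
- exact: (measurableT_comp (measurable_prefixt _)).
Qed.

End processes.

(** * Joint densities and their marginals *)

Section densities.
Context (R : realType) (dX dY : measure_display).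
Context (X : measurableType dX) (Y : measurableType dY).
Context (mu : {sigma_finite_measure set Y -> \bar R}).
Context (k : nat) (f : 'I_k -> X -> Y -> R).
Hypothesis hf : is_density_family mu f.
Implicit Types (chi : policy X Y) (psi : stopping R X Y).

Lemma joint_densityS i n (x : n.-tuple X) u (y : n.-tuple Y) z :
  joint_density f i (rconst x u) (rconst y z) =
  (joint_density f i x y * f i u z)%R.
Proof.
rewrite /joint_density big_ord_recr /= !tnth_rconst_last//; congr (_ * _)%R.
apply: eq_bigr => m _.
rewrite !(@tnth_rconst_widen _ _ _ _ (widen_ord (leqnSn n) m) (ltn_ord m)).
by rewrite (_ : Ordinal _ = m)//; exact/val_inj.
Qed.

Lemma joint_density_ge0 i n (x : n.-tuple X) (y : n.-tuple Y) :
  (0 <= joint_density f i x y)%R.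
Proof. by apply: prodr_ge0 => m _; have [_ + _] := hf i; exact. Qed.

Lemma measurable_joint_density i n :
  jointly_measurable n (@joint_density _ _ _ X Y k f i n).
Proof.
apply: measurable_prod => m _; have [mf _ _] := hf i.
apply: (measurable_fun_comp2 mf).
- exact: (measurableT_comp (measurable_tnth _)).
- exact: (measurableT_comp (measurable_tnth _)).
Qed.

Lemma measurable_density i u : measurable_fun setT (fun z => (f i u z)%:E).
Proof.
apply/measurable_EFinP; have [mf _ _] := hf i.
exact: (measurableT_comp mf (pair1_measurable u)).
Qed.

Lemma integral_joint_densityS i n (x : n.-tuple X) u (y : n.-tuple Y) :
  \int[mu]_z (joint_density f i (rconst x u) (rconst y z))%:E =
  (joint_density f i x y)%:E.
Proof.
have [_ f0 f1] := hf i.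
under eq_integral do rewrite joint_densityS EFinM.
rewrite ge0_integralZl_EFin//.
- by rewrite f1 mule1.
- by move=> z _; rewrite lee_fin.
- exact: measurable_density.
- exact: joint_density_ge0.
Qed.

(** The control of stage n + 1 is a function of the first n observations alone; once these are
    fixed, the last density factor integrates to 1. *)
Lemma integral_marginal chi i n (g : n.-tuple Y -> R) :
  is_policy chi -> (forall y, 0 <= g y)%R -> measurable_fun setT g ->
  \int[power_measure mu n.+1]_y
    (g (prefixt (leqnSn n) y) * along chi (joint_density f i (n:=n.+1)) y)%:E =
  \int[power_measure mu n]_y
    (g y * along chi (joint_density f i (n:=n)) y)%:E.
Proof.
move=> chiP g0 mg; rewrite integral_power_measureS; last 2 first.
- by move=> y; rewrite lee_fin mulr_ge0// joint_density_ge0.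
- apply/measurable_EFinP/measurable_funM.
  exact: (measurableT_comp mg (measurable_prefixt (leqnSn n))).
  by apply: measurable_along => //; exact: measurable_joint_density.
apply: eq_integral => y _.
under eq_integral => z _.
  rewrite (prefixt_rconst _ (leqnn n)) prefixt_id /along controls_rconst EFinM.
  over.
rewrite ge0_integralZl_EFin//.
- by rewrite integral_joint_densityS.
- by move=> z _; rewrite lee_fin joint_density_ge0.
- under eq_fun do rewrite joint_densityS EFinM.
  by apply: measurable_funeM; exact: measurable_density.
Qed.

End densities.

Lemma measurable_bigmine d (T : measurableType d) (R : realType) (I : Type)
    (s : seq I) (h : I -> T -> \bar R) :
  (forall i, measurable_fun setT (h i)) ->
  measurable_fun setT (fun t => \big[Order.min/+oo]_(i <- s) h i t).
Proof.
move=> mh; elim: s => [|i s IHs].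
  by under eq_fun do rewrite big_nil; exact: measurable_cst.
by under eq_fun do rewrite big_cons; exact: measurable_mine.
Qed.

(** * Minimisation over the next control *)

Section min_control.
Context (R : realType) (dX dY : measure_display).
Context (X : measurableType dX) (Y : measurableType dY).
Context (mu : {sigma_finite_measure set Y -> \bar R}).
Context (n : nat).
Implicit Types G H : n.+1.-tuple X -> n.+1.-tuple Y -> \bar R.

Lemma measurable_rconst_section d (T : measurableType d)
    (G : n.+1.-tuple X -> n.+1.-tuple Y -> T) x u y :
  jointly_measurable n.+1 G ->
  measurable_fun setT (fun z => G (rconst x u) (rconst y z)).
Proof.
move=> mG; apply: (measurable_fun_comp2 mG) => //.
exact: measurable_rconst.
Qed.

Lemma next_cost_le G H x y u :
  (forall x y, 0 <= G x y) -> (forall x y, G x y <= H x y) ->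
  jointly_measurable n.+1 G -> jointly_measurable n.+1 H ->
  next_cost mu G x y u <= next_cost mu H x y u.
Proof.
move=> G0 GH mG mH.
by apply: ge0_le_integral => //; exact: measurable_rconst_section.
Qed.

Lemma min_control_le G H x y :
  (forall x y, 0 <= G x y) -> (forall x y, G x y <= H x y) ->
  jointly_measurable n.+1 G -> jointly_measurable n.+1 H ->
  min_control mu G x y <= min_control mu H x y.
Proof.
move=> G0 GH mG mH; apply/ereal_infP => _ [u _ <-]; apply: ereal_inf_le.
by exists (next_cost mu G x y u); [exists u|exact: next_cost_le].
Qed.

Lemma min_control_ge0 G x y : (forall x y, 0 <= G x y) ->
  0 <= min_control mu G x y.
Proof.
by move=> G0; apply/ereal_infP => _ [u _ <-]; exact: integral_ge0.
Qed.

Lemma min_control_le_next_cost G x y u :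
  min_control mu G x y <= next_cost mu G x y u.
Proof. by apply: ereal_inf_lbound; exists u. Qed.

End min_control.

(** * The value functions V_n and R_n and their recursion *)

Section value_functions.
Context (R : realType) (dX dY : measure_display).
Context (X : measurableType dX) (Y : measurableType dY).
Context (mu : {sigma_finite_measure set Y -> \bar R}).
Context (k : nat) (hk : (1 < k)%N) (f : 'I_k -> X -> Y -> R).
Hypothesis hf : is_density_family mu f.
Variable lam : 'I_k -> 'I_k -> R.
Hypothesis hlam : forall i j, i != j -> (0 < lam i j)%R.

Let lam_ge0 i j : i != j -> (0 <= lam i j)%R.
Proof. by move=> /hlam/ltW. Qed.

Lemma accept_loss_ge0 j n (x : n.-tuple X) (y : n.-tuple Y) :
  (0 <= accept_loss f lam j x y)%R.
Proof.
apply: sumr_ge0 => i ij; rewrite mulr_ge0 ?lam_ge0//.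
exact: (joint_density_ge0 hf).
Qed.

Lemma measurable_accept_loss j n :
  jointly_measurable n (@accept_loss _ _ _ X Y k f lam j n).
Proof.
rewrite /accept_loss; under eq_fun do rewrite -big_filter.
apply: measurable_sum => i; apply: measurable_funM => //.
exact: (measurable_joint_density hf).
Qed.

(** A martingale property: one more observation, under any control [u], leaves the loss of accepting
    [j] unchanged on average. It supplies the integrable majorants below. *)
Lemma integral_accept_lossS j n (x : n.-tuple X) u (y : n.-tuple Y) :
  \int[mu]_z (accept_loss f lam j (rconst x u) (rconst y z))%:E =
  (accept_loss f lam j x y)%:E.
Proof.
have mjd i : measurable_fun setT (fun z =>
    (joint_density f i (rconst x u) (rconst y z))%:E).
  apply/measurable_EFinP.
  apply: (measurable_rconst_section (G := joint_density f i (n:=n.+1))).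
  exact: (measurable_joint_density hf).
rewrite /accept_loss; under eq_integral do rewrite -sumEFin.
rewrite ge0_integral_sum_cond; last 2 first.
- by move=> i ij; under eq_fun do rewrite EFinM; exact: measurable_funeM.
- by move=> i z ij; rewrite lee_fin mulr_ge0 ?lam_ge0// (joint_density_ge0 hf).
rewrite -sumEFin; apply: eq_bigr => i ij; under eq_integral do rewrite EFinM.
rewrite ge0_integralZl_EFin ?lam_ge0//.
- by rewrite (integral_joint_densityS hf) EFinM.
- by move=> z _; rewrite lee_fin (joint_density_ge0 hf).
Qed.

Lemma min_loss_le j n (x : n.-tuple X) (y : n.-tuple Y) :
  min_loss f lam x y <= (accept_loss f lam j x y)%:E.
Proof. exact: bigmin_le. Qed.

Lemma min_loss_attained n (x : n.-tuple X) (y : n.-tuple Y) :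
  exists j, min_loss f lam x y = (accept_loss f lam j x y)%:E.
Proof.
have [j _ jE] := @eq_bigmin _ _ _ +oo (H1 hk) predT
  (fun j => (accept_loss f lam j x y)%:E) isT (fun j _ => leey _).
by exists j.
Qed.

Lemma min_loss_ge0 n (x : n.-tuple X) (y : n.-tuple Y) :
  0 <= min_loss f lam x y.
Proof.
have [j ->] := min_loss_attained x y; rewrite lee_fin; exact: accept_loss_ge0.
Qed.

Lemma min_loss_fin n (x : n.-tuple X) (y : n.-tuple Y) :
  min_loss f lam x y \is a fin_num.
Proof. by have [j ->] := min_loss_attained x y. Qed.

Lemma measurable_min_loss n :
  jointly_measurable n (@min_loss _ _ _ X Y k f lam n).
Proof.
apply: measurable_bigmine => j; apply/measurable_EFinP.
exact: measurable_accept_loss.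
Qed.

(** Any fixed decision bounds the minimum, here acceptance of [H1 hk]. The result serves twice: it
    makes R_n finite and makes l_(n+1) a majorant for dominated convergence. *)
Lemma integral_min_loss_lty n (x : n.-tuple X) u (y : n.-tuple Y) :
  \int[mu]_z min_loss f lam (rconst x u) (rconst y z) < +oo.
Proof.
apply: (@le_lt_trans _ _ (accept_loss f lam (H1 hk) x y)%:E); last exact: ltry.
rewrite -(integral_accept_lossS _ x u); apply: ge0_le_integral => //.
- by move=> z _; exact: min_loss_ge0.
- by apply: measurable_rconst_section; exact: measurable_min_loss.
- apply/measurable_EFinP.
  apply: (measurable_rconst_section (G := accept_loss f lam _ (n:=n.+1))).
  exact: measurable_accept_loss.
- by move=> z _; exact: min_loss_le.
Qed.

Lemma backward_ge0 p n (x : n.-tuple X) (y : n.-tuple Y) :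
  0 <= backward mu hk f lam p x y.
Proof.
elim: p n x y => [|p IHp] n x y /=; first exact: min_loss_ge0.
rewrite le_min min_loss_ge0/= adde_ge0//; last exact: min_control_ge0.
rewrite lee_fin; exact: (joint_density_ge0 hf).
Qed.

Hypothesis hmin : minima_ok mu hk f lam.

Lemma measurable_backward p n :
  jointly_measurable n.+1 (@backward _ _ _ X Y mu k hk f lam p n.+1).
Proof.
case: p => [|p] /=; first exact: measurable_min_loss.
apply: measurable_mine; first exact: measurable_min_loss.
apply: emeasurable_funD.
  apply/measurable_EFinP; exact: (measurable_joint_density hf).
(* With the horizon N = n + 2 + p, the function V_(n+2)^N is [backward p], so the standing
   assumption covers it. *)
have := (hmin.1 (n.+2 + p)%N n.+1); rewrite /= ltnS leq_addr.
by move=> /(_ isT)[_]; rewrite /VN addKn.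
Qed.

(** A later horizon adds the option of continuing where stopping was forced; the minimum over
    controls is monotone and carries the gain back to earlier stages. *)
Lemma backwardS_le p n (x : n.+1.-tuple X) (y : n.+1.-tuple Y) :
  backward mu hk f lam p.+1 x y <= backward mu hk f lam p x y.
Proof.
elim: p n x y => [|p IHp] n x y.
  by rewrite /= ge_min lexx.
rewrite [leLHS]/= [leRHS]/= le_min !ge_min lexx/=; apply/orP; right.
rewrite leeD2l//.
apply: (@min_control_le _ _ _ _ _ mu _ (@backward _ _ _ _ _ mu k hk f lam p.+1 _)).
- by move=> *; exact: backward_ge0.
- by move=> *; exact: IHp.
- exact: measurable_backward.
- exact: measurable_backward.
Qed.

(** For N below the stage, truncated subtraction makes V_n^N equal to l_n, so monotonicity holds
    from N = 0 on and the limit needs no shift of index. *)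
Lemma VN_nonincreasing n (x : n.+1.-tuple X) (y : n.+1.-tuple Y) :
  {homo (fun N => VN mu hk f lam N x y) : N M / (N <= M)%N >-> M <= N}.
Proof.
have bw p q : (p <= q)%N ->
    backward mu hk f lam q x y <= backward mu hk f lam p x y.
  elim: q => [|q IHq]; first by rewrite leqn0 => /eqP ->.
  rewrite leq_eqVlt => /predU1P[->//|]; rewrite ltnS => /IHq.
  exact/le_trans/backwardS_le.
by move=> N M NM; apply: bw; exact: leq_sub2r.
Qed.

Lemma VN_cvg n (x : n.+1.-tuple X) (y : n.+1.-tuple Y) :
  VN mu hk f lam N x y @[N --> \oo] --> V mu hk f lam x y.
Proof.
have VNcvg := ereal_nonincreasing_cvgn (VN_nonincreasing x y).
by rewrite /V (cvg_lim _ VNcvg).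
Qed.

Lemma V_le_VN N n (x : n.+1.-tuple X) (y : n.+1.-tuple Y) :
  V mu hk f lam x y <= VN mu hk f lam N x y.
Proof.
have VNcvg := ereal_nonincreasing_cvgn (VN_nonincreasing x y).
rewrite /V (cvg_lim _ VNcvg)//; apply: ereal_inf_lbound.
by exists N.
Qed.

Lemma V_ge n (x : n.+1.-tuple X) (y : n.+1.-tuple Y) c :
  (forall N, c <= VN mu hk f lam N x y) -> c <= V mu hk f lam x y.
Proof.
move=> cVN; apply: lime_ge; last exact: nearW.
by apply/cvg_ex; exists (V mu hk f lam x y); exact: VN_cvg.
Qed.

Lemma V_ge0 n (x : n.+1.-tuple X) (y : n.+1.-tuple Y) :
  0 <= V mu hk f lam x y.
Proof. by apply: V_ge => N; exact: backward_ge0. Qed.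

Lemma V_le_min_loss n (x : n.+1.-tuple X) (y : n.+1.-tuple Y) :
  V mu hk f lam x y <= min_loss f lam x y.
Proof. by rewrite (le_trans (V_le_VN n.+1 x y))// VN_last. Qed.

Lemma V_fin n (x : n.+1.-tuple X) (y : n.+1.-tuple Y) :
  V mu hk f lam x y \is a fin_num.
Proof.
rewrite ge0_fin_numE ?V_ge0// (le_lt_trans (V_le_min_loss x y))//.
by rewrite -ge0_fin_numE ?min_loss_fin// min_loss_ge0.
Qed.

Lemma measurable_V n :
  jointly_measurable n.+1 (@V _ _ _ X Y mu k hk f lam n.+1).
Proof.
apply: (emeasurable_fun_cvg (fun N h => VN mu hk f lam N h.1 h.2)).
- by move=> N; exact: measurable_backward.
- by move=> h _; exact: VN_cvg.
Qed.

Lemma Rn_ge0 n (x : n.-tuple X) (y : n.-tuple Y) : 0 <= Rn mu hk f lam x y.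
Proof. by apply: min_control_ge0 => *; exact: V_ge0. Qed.

Lemma measurable_Rn n :
  jointly_measurable n (@Rn _ _ _ X Y mu k hk f lam n).
Proof. by have [] := hmin.2 n. Qed.

Lemma Rn_fin n (x : n.-tuple X) (y : n.-tuple Y) :
  Rn mu hk f lam x y \is a fin_num.
Proof.
rewrite ge0_fin_numE ?Rn_ge0//.
have [/(_ x y)[u uE] _] := hmin.2 n; rewrite /Rn -uE.
apply: le_lt_trans (integral_min_loss_lty x u y).
apply: next_cost_le.
- by move=> *; exact: V_ge0.
- by move=> *; exact: V_le_min_loss.
- exact: measurable_V.
- exact: measurable_min_loss.
Qed.

(** The lower bound holds because the limit is below each V^N inside the finite-horizon recursion.
    For the upper bound, R_n is tested at a control [u] attaining it: V_n <= f_1^n + int V_(n+1)^N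
    at [u] for all large N, and these integrals converge by dominated convergence. *)
Lemma V_rec n (x : n.+1.-tuple X) (y : n.+1.-tuple Y) :
  V mu hk f lam x y = Order.min (min_loss f lam x y)
    ((joint_density f (H1 hk) x y)%:E + Rn mu hk f lam x y).
Proof.
apply/eqP; rewrite eq_le; apply/andP; split; last first.
  apply: V_ge => N; have [nN|Nn] := ltnP n.+1 N.
    rewrite VN_rec// le_min !ge_min lexx/=; apply/orP; right.
    rewrite leeD2l//; apply: min_control_le.
    - by move=> *; exact: V_ge0.
    - by move=> *; exact: V_le_VN.
    - exact: measurable_V.
    - exact: measurable_backward.
  (* [Nn] is by definition of [leq] the equation [N - n.+1 == 0]; the horizon is passed and V^N is
     the stopping loss. *)
  by rewrite /VN (eqP Nn) ge_min lexx.
rewrite le_min V_le_min_loss/=.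
have [/(_ x y)[u uE] _] := hmin.2 n.+1.
rewrite /Rn -uE.
have cvg_cost : next_cost mu (@VN _ _ _ X Y mu k hk f lam N n.+2) x y u
    @[N --> \oo] --> next_cost mu (@V _ _ _ X Y mu k hk f lam n.+2) x y u.
  apply: (@dominated_cvg _ _ _ mu setT measurableT
    (fun N z => VN mu hk f lam N (rconst x u) (rconst y z)) _
    (fun z => min_loss f lam (rconst x u) (rconst y z))).
  - move=> N; by apply: measurable_rconst_section; exact: measurable_backward.
  - by move=> z _; exact: VN_cvg.
  - by move=> z _; exact: min_loss_fin.
  - apply/integrableP; split.
      by apply: measurable_rconst_section; exact: measurable_min_loss.
    under eq_integral do rewrite gee0_abs ?min_loss_ge0//.
    exact: integral_min_loss_lty.
  - move=> N z _; rewrite gee0_abs; last exact: backward_ge0.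
    (* At horizon 0 the function V^0 reduces to the stopping loss, which is the majorant. *)
    have := VN_nonincreasing (rconst x u) (rconst y z) (leq0n N).
    by [].
have cvg_sum : (joint_density f (H1 hk) x y)%:E +
      next_cost mu (@VN _ _ _ X Y mu k hk f lam N n.+2) x y u @[N --> \oo] -->
    (joint_density f (H1 hk) x y)%:E +
      next_cost mu (@V _ _ _ X Y mu k hk f lam n.+2) x y u.
  by apply: cvgeD => //; exact: cvg_cst.
rewrite -(cvg_lim _ cvg_sum)//; apply: lime_ge.
  by apply/cvg_ex; eexists; exact: cvg_sum.
near=> N; rewrite (le_trans (V_le_VN N x y))// VN_rec//.
  rewrite ge_min; apply/orP; right.
  by rewrite leeD2l//; exact: min_control_le_next_cost.
by near: N; exact: nbhs_infty_gt.
Unshelve. all: by end_near. Qed.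

End value_functions.

(* The sign of [u 0] is left free: the functions [psi 0] and [phi 0] are
   unconstrained, so [stop_at] and the summand of [alpha] may be negative at 0. *)
Lemma eseries_shift1 (R : realType) (u : nat -> \bar R) :
  (forall n, 0 <= u n.+1) ->
  \sum_(1 <= n <oo) u n = \sum_(0 <= n <oo) u n.+1.
Proof.
move=> u0; apply: cvg_lim => //; rewrite -cvg_shiftS.
have -> : [sequence \sum_(1 <= i < n.+1) u i]_n =
    fun n => \sum_(0 <= i < n) u i.+1.
  by apply/funext => n /=; rewrite big_add1.
exact: is_cvg_nneseries.
Qed.

(** * Telescoping inequalities and their equality case *)

Section telescoping_bound.
Context (R : realType) (a b r : nat -> \bar R).
Hypotheses (a0 : forall n, 0 <= a n) (b0 : forall n, 0 <= b n).
Hypotheses (abr : forall n, a n <= b n + r n) (ra : forall n, r n <= a n.+1).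
Hypothesis a_cvg0 : a n @[n --> \oo] --> 0.

(** Cost already paid plus value still ahead. It never decreases, starts at [a 0] and, as [a]
    vanishes at infinity, tends to the full sum of [b]. *)
Let A n := \sum_(0 <= i < n) b i + a n.

Let A_cvg : A n @[n --> \oo] --> \sum_(0 <= n <oo) b n.
Proof.
rewrite -[X in _ --> X]adde0; apply: cvgeD => //.
- exact: fin_num_adde_defl.
- exact: is_cvg_nneseries.
Qed.

Let AS n : A n.+1 = \sum_(0 <= i < n) b i + (b n + a n.+1).
Proof. by rewrite /A big_nat_recr//= addeA. Qed.

Let A_nd : {homo A : n m / (n <= m)%N >-> n <= m}.
Proof.
apply/nondecreasing_seqP => n; rewrite AS leeD2l//.
by rewrite (le_trans (abr n))// leeD2l.
Qed.

Let A0 : A 0 = a 0%N.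
Proof. by rewrite /A big_geq// add0e. Qed.

Let A_le n : A n <= \sum_(0 <= n <oo) b n.
Proof.
rewrite -(cvg_lim _ A_cvg)//; apply: lime_ge.
  by apply/cvg_ex; eexists; exact: A_cvg.
by near=> m; apply: A_nd; near: m; exact: nbhs_infty_ge.
Unshelve. all: by end_near. Qed.

Lemma telescoping_le : a 0%N <= \sum_(0 <= n <oo) b n.
Proof. by rewrite -A0. Qed.

(** A monotone [A] with equal ends is constant, so both inequalities of every step are equalities.
    Finiteness of [a 0] bounds all partial sums, which can then be cancelled. *)
Lemma telescoping_eqP : a 0%N \is a fin_num ->
  \sum_(0 <= n <oo) b n = a 0%N <->
  forall n, a n = b n + r n /\ r n = a n.+1.
Proof.
move=> afin; split => [bE n|abrE]; last first.
  have AE n : A n = a 0%N.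
    elim: n => // n <-; rewrite AS; congr (_ + _).
    by have [-> ->] := abrE n.
  rewrite -(cvg_lim _ A_cvg)//; apply: cvg_lim => //.
  by rewrite (_ : A = cst (a 0%N)); [exact: cvg_cst|exact/funext].
have AE m : A m = a 0%N.
  by apply/eqP; rewrite eq_le -{1}bE A_le/= -A0 A_nd.
have sum_fin m : \sum_(0 <= i < m) b i \is a fin_num.
  rewrite ge0_fin_numE ?sume_ge0//; apply: (@le_lt_trans _ _ (A m)).
    by rewrite leeDl.
  by rewrite AE -ge0_fin_numE.
have bfin : b n \is a fin_num.
  have := sum_fin n.+1; rewrite big_nat_recr//= fin_numD.
  by case/andP.
have /eqP : A n = A n.+1 by rewrite !AE.
rewrite AS /A eq_le !leeD2lE// => /andP[_ ba].
have brE : b n + a n.+1 = b n + r n.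
  by apply/eqP; rewrite eq_le (le_trans ba (abr n)) leeD2l.
split.
  by apply/eqP; rewrite eq_le abr/= -brE.
by apply/eqP; rewrite eq_le ra/= -(leeD2lE _ _ bfin) brE.
Qed.

End telescoping_bound.

(** The difference [h \- g] is non-negative with integral 0. Finite values of [g] give sense to the
    subtraction, and its finite integral allows cancelling. *)
Lemma ge0_eq_integral_aeP d (T : measurableType d) (R : realType)
    (nu : {measure set T -> \bar R}) (g h : T -> \bar R) :
  measurable_fun setT g -> measurable_fun setT h ->
  (forall x, 0 <= g x) -> (forall x, g x \is a fin_num) ->
  (forall x, g x <= h x) -> \int[nu]_x g x < +oo ->
  \int[nu]_x g x = \int[nu]_x h x <-> {ae nu, forall x, g x = h x}.
Proof.
move=> mg mh g0 gfin gh intg; split => [ghE|]; last first.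
  move=> gh_ae; apply: ge0_ae_eq_integral => //.
    by move=> x _; exact: le_trans (gh x).
  by apply: filterS gh_ae.
have mhg : measurable_fun setT (h \- g) by exact: emeasurable_funB.
have hg0 x : 0 <= h x - g x by rewrite sube_ge0 ?gfin.
have hE : \int[nu]_x h x = \int[nu]_x g x + \int[nu]_x (h x - g x).
  rewrite -ge0_integralD//; apply: eq_integral => x _.
  by rewrite addeC subeK.
have hg_eq0 : \int[nu]_x (h x - g x) = 0.
  apply/eqP; rewrite eq_le integral_ge0// andbT.
  rewrite -(@leeD2lE _ (\int[nu]_x g x)); last first.
    by rewrite ge0_fin_numE// integral_ge0.
  by rewrite -hE -ghE adde0.
have /ae_eq_integral_abs : \int[nu]_x `|(h \- g) x| = 0.
  by under eq_integral do rewrite /= gee0_abs//.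
move=> /(_ measurableT mhg); apply: filterS => x /(_ Logic.I) /= hg.
by rewrite -[RHS](subeK _ (gfin x)) hg add0e.
Qed.

(** * A minimum against a convex combination *)

Section convex_min.
Context (R : realType).
Implicit Types (c p l v : R).

Lemma mine_le_convex c p l v : (0 <= c)%R -> (0 <= p <= 1)%R ->
  c%:E * Order.min l%:E v%:E <=
  (c * p)%:E * l%:E + (c * (1 - p))%:E * v%:E.
Proof.
move=> c0 /andP[p0 p1]; rewrite -EFin_min -!EFinM -EFinD lee_fin.
have q0 : (0 <= c * (1 - p))%R by rewrite mulr_ge0// subr_ge0.
have -> : (c * Num.min l v =
    c * p * Num.min l v + c * (1 - p) * Num.min l v)%R by ring.
apply: lerD; apply: ler_wpM2l => //.
- exact: mulr_ge0.
- by rewrite ge_min lexx.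
- by rewrite ge_min lexx orbT.
Qed.

(** Here [c] is the weight of reaching a stage, [p] the probability of stopping there, [l] and [v]
    the losses of stopping and continuing. Equality puts all weight on the smaller loss, leaves [p]
    free at a tie and says nothing when [c] is 0: this is condition (a), with its restriction to
    C_r. *)
Lemma mine_eq_convexP c p l v : (0 <= c)%R -> (0 <= p <= 1)%R ->
  c%:E * Order.min l%:E v%:E =
    (c * p)%:E * l%:E + (c * (1 - p))%:E * v%:E <->
  ((0 < c)%R -> ((l%:E < v%:E)%E%:R <= p <= (l%:E <= v%:E)%E%:R)%R).
Proof.
move=> c0 /andP[p0 p1]; rewrite -EFin_min -!EFinM -EFinD.
rewrite lte_fin lee_fin.
split => [[]|].
  move=> cE cgt0; have {}cE : (Num.min l v = p * l + (1 - p) * v)%R.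
    apply: (mulfI (lt0r_neq0 cgt0)); rewrite cE; ring.
  case: (ltgtP l v) cE => lv cE /=.
  - rewrite p1 andbT.
    have : ((1 - p) * (v - l) = 0)%R by nra.
    move/eqP; rewrite mulf_eq0 !subr_eq0 (gt_eqF lv) orbF => /eqP <-//.
  - rewrite p0/=.
    have : (p * (l - v) = 0)%R by nra.
    move/eqP; rewrite mulf_eq0 subr_eq0 (gt_eqF lv) orbF => /eqP ->//.
  - by rewrite p0 p1.
move=> H; congr (_%:E).
have [c00|cneq0] := eqVneq c 0%R; first by rewrite c00; ring.
have /H : (0 < c)%R by rewrite lt0r cneq0.
case: ltgtP => [lv|lv|<-] /= /andP[pl pu].
- have -> : p = 1%R by apply/eqP; rewrite eq_le p1.
  ring.
- have -> : p = 0%R by apply/eqP; rewrite eq_le pu.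
  ring.
- ring.
Qed.

End convex_min.

Lemma indic_setb (T : Type) (R : pzRingType) (P : pred T) t :
  \1_[set u | P u] t = (P t)%:R :> R.
Proof.
by rewrite indicE (_ : (t \in _) = P t)//; apply/idP/idP; rewrite inE.
Qed.

(** * One-stage inequalities and conditions (a), (b) *)

Section stage_costs.
Context (R : realType) (dX dY : measure_display).
Context (X : measurableType dX) (Y : measurableType dY).
Context (mu : {sigma_finite_measure set Y -> \bar R}).
Context (k : nat) (hk : (1 < k)%N) (f : 'I_k -> X -> Y -> R).
Hypothesis hf : is_density_family mu f.
Variable lam : 'I_k -> 'I_k -> R.
Hypothesis hlam : forall i j, i != j -> (0 < lam i j)%R.
Hypothesis hmin : minima_ok mu hk f lam.
Variables (chi : policy X Y) (psi : stopping R X Y).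
Hypotheses (chiP : is_policy chi) (psiP : is_stopping psi).

(* [value_before n] and [value_after n] are the minimal expected losses of the
   remaining stages, accounted just before and just after the decision whether
   to stop at stage [n]; between the two, [stage_cost n] is incurred. *)
Definition stop_loss n : \bar R :=
  \int[power_measure mu n]_y
    ((along chi (reach psi (n:=n)) y * along chi (@psi n) y)%:E *
     along chi (min_loss f lam (n:=n)) y).

Definition stage_cost n : \bar R :=
  stop_loss n + expect mu f chi (H1 hk) (survive psi (n:=n)).

Definition value_before n : \bar R :=
  \int[power_measure mu n]_y
    ((along chi (reach psi (n:=n)) y)%:E *
     along chi (V mu hk f lam (n:=n)) y).

Definition value_after n : \bar R :=
  \int[power_measure mu n]_y
    ((along chi (survive psi (n:=n)) y)%:E *
     along chi (Rn mu hk f lam (n:=n)) y).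

Let mreach n : measurable_fun setT (along chi (reach psi (n:=n.+1))).
Proof. by apply: measurable_along => //; exact: measurable_reach. Qed.

Let msurvive n : measurable_fun setT (along chi (survive psi (n:=n))).
Proof. by apply: measurable_along => //; exact: measurable_survive. Qed.

Let mpsi n : measurable_fun setT (along chi (@psi n.+1)).
Proof. by apply: measurable_along => //; have [] := psiP (ltn0Sn n). Qed.

Let mdens i n : measurable_fun setT (along chi (joint_density f i (n:=n))).
Proof.
by apply: measurable_along => //; exact: (measurable_joint_density hf).
Qed.

Let mloss n : measurable_fun setT (along chi (min_loss f lam (n:=n))).
Proof.
by apply: measurable_along => //; exact: (measurable_min_loss hf).
Qed.

Let mV n : measurable_fun setT (along chi (V mu hk f lam (n:=n.+1))).
Proof. by apply: measurable_along => //; exact: measurable_V. Qed.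

Let mRn n : measurable_fun setT (along chi (Rn mu hk f lam (n:=n))).
Proof. by apply: measurable_along => //; exact: measurable_Rn. Qed.

Let reach0 n y : (0 <= along chi (reach psi (n:=n.+1)) y)%R.
Proof. exact: reach_ge0. Qed.

Let survive0 n y : (0 <= along chi (survive psi (n:=n)) y)%R.
Proof. exact: survive_ge0. Qed.

Let psi01 n y : (0 <= along chi (@psi n.+1) y <= 1)%R.
Proof. by have [_] := psiP (ltn0Sn n); apply. Qed.

Let psi0 n y : (0 <= along chi (@psi n.+1) y)%R.
Proof. by have /andP[] := psi01 y. Qed.

Let dens0 i n y : (0 <= along chi (joint_density f i (n:=n)) y)%R.
Proof. exact: (joint_density_ge0 hf). Qed.

Let loss0 n y : 0 <= along chi (min_loss f lam (n:=n)) y.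
Proof. exact: (min_loss_ge0 hk hf). Qed.

Let V0 n y : 0 <= along chi (V mu hk f lam (n:=n.+1)) y.
Proof. exact: V_ge0. Qed.

Let Rn0 n y : 0 <= along chi (Rn mu hk f lam (n:=n)) y.
Proof. exact: Rn_ge0. Qed.

(** The integrand of [stage_cost] plus [value_after], to be compared pointwise with that of
    [value_before]. *)
Let mixed n y : \bar R :=
  (along chi (reach psi (n:=n.+1)) y * along chi (@psi n.+1) y)%:E *
    along chi (min_loss f lam (n:=n.+1)) y +
  ((along chi (survive psi (n:=n.+1)) y *
    along chi (joint_density f (H1 hk) (n:=n.+1)) y)%:E +
   (along chi (survive psi (n:=n.+1)) y)%:E *
     along chi (Rn mu hk f lam (n:=n.+1)) y).

(** As [survive] is [reach] times 1 - psi, the integrand is a convex combination of the losses of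
    stopping and continuing, scaled by [reach]. Both losses are finite, and [fine] gives them the
    real form of the lemmas on convex combinations. *)
Let mixedE n y : mixed y =
  (along chi (reach psi (n:=n.+1)) y * along chi (@psi n.+1) y)%:E *
    (fine (along chi (min_loss f lam (n:=n.+1)) y))%:E +
  (along chi (reach psi (n:=n.+1)) y * (1 - along chi (@psi n.+1) y))%:E *
   (along chi (joint_density f (H1 hk) (n:=n.+1)) y +
     fine (along chi (Rn mu hk f lam (n:=n.+1)) y))%:E.
Proof.
have sE : along chi (survive psi (n:=n.+1)) y =
    (along chi (reach psi (n:=n.+1)) y * (1 - along chi (@psi n.+1) y))%R.
  by rewrite /along survive_reach.
rewrite /mixed sE fineK; last exact: min_loss_fin.
rewrite EFinD fineK; last exact: (Rn_fin hf).
by rewrite EFinM muleDr.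
Qed.

Let V_recE n y : along chi (V mu hk f lam (n:=n.+1)) y = Order.min
  (fine (along chi (min_loss f lam (n:=n.+1)) y))%:E
  (along chi (joint_density f (H1 hk) (n:=n.+1)) y +
   fine (along chi (Rn mu hk f lam (n:=n.+1)) y))%:E.
Proof.
rewrite EFinD !fineK; [|exact: (Rn_fin hf)|exact: min_loss_fin].
by rewrite {1}/along (V_rec hf).
Qed.

Let V_le_mixed n y :
  (along chi (reach psi (n:=n.+1)) y)%:E *
     along chi (V mu hk f lam (n:=n.+1)) y <= mixed y.
Proof. by rewrite V_recE mixedE; exact: mine_le_convex. Qed.

Let m_stop_loss n : measurable_fun setT (fun y =>
  (along chi (reach psi (n:=n.+1)) y * along chi (@psi n.+1) y)%:E *
    along chi (min_loss f lam (n:=n.+1)) y).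
Proof.
apply: emeasurable_funM; last exact: mloss.
by apply/measurable_EFinP; apply: measurable_funM; [exact: mreach|exact: mpsi].
Qed.

Let m_survive_dens i n : measurable_fun setT (fun y =>
  (along chi (survive psi (n:=n)) y *
    along chi (joint_density f i (n:=n)) y)%:E).
Proof.
apply/measurable_EFinP; apply: measurable_funM; [exact: msurvive|exact: mdens]. Qed.

Let m_value_after n : measurable_fun setT (fun y =>
  (along chi (survive psi (n:=n)) y)%:E * along chi (Rn mu hk f lam (n:=n)) y).
Proof.
apply: emeasurable_funM; last exact: mRn.
by apply/measurable_EFinP; exact: msurvive.
Qed.

Let m_value_before n : measurable_fun setT (fun y =>
  (along chi (reach psi (n:=n.+1)) y)%:E *
  along chi (V mu hk f lam (n:=n.+1)) y).
Proof.
apply: emeasurable_funM; last exact: mV.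
by apply/measurable_EFinP; exact: mreach.
Qed.

Let mmixed n : measurable_fun setT (@mixed n).
Proof.
apply: emeasurable_funD; first exact: m_stop_loss.
by apply: emeasurable_funD; [exact: m_survive_dens|exact: m_value_after].
Qed.

Let integral_mixed n :
  \int[power_measure mu n.+1]_y mixed y =
  stage_cost n.+1 + value_after n.+1.
Proof.
have sl0 y : 0 <=
    (along chi (reach psi (n:=n.+1)) y * along chi (@psi n.+1) y)%:E *
      along chi (min_loss f lam (n:=n.+1)) y.
  by rewrite mule_ge0// lee_fin mulr_ge0.
have sd0 y : 0 <= (along chi (survive psi (n:=n.+1)) y *
    along chi (joint_density f (H1 hk) (n:=n.+1)) y)%:E.
  by rewrite lee_fin mulr_ge0.
have va0 y : 0 <= (along chi (survive psi (n:=n.+1)) y)%:E *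
     along chi (Rn mu hk f lam (n:=n.+1)) y.
  by rewrite mule_ge0// lee_fin.
rewrite /mixed ge0_integralD//; last 3 first.
- exact: m_stop_loss.
- by move=> y _; rewrite adde_ge0.
- by apply: emeasurable_funD; [exact: m_survive_dens|exact: m_value_after].
rewrite ge0_integralD//; first by rewrite addeA.
- exact: m_survive_dens.
- exact: m_value_after.
Qed.

Lemma value_before_ge0 n : 0 <= value_before n.+1.
Proof. by apply: integral_ge0 => y _; rewrite mule_ge0// lee_fin. Qed.

Lemma stop_loss_ge0 n : 0 <= stop_loss n.+1.
Proof.
by apply: integral_ge0 => y _; rewrite mule_ge0// lee_fin mulr_ge0.
Qed.

Lemma expect_survive_ge0 i n :
  0 <= expect mu f chi i (survive psi (n:=n)).
Proof. by apply: integral_ge0 => y _; rewrite lee_fin mulr_ge0. Qed.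

Lemma stage_cost_ge0 n : 0 <= stage_cost n.+1.
Proof. by rewrite adde_ge0 ?stop_loss_ge0 ?expect_survive_ge0. Qed.

Lemma value_before_le n :
  value_before n.+1 <= stage_cost n.+1 + value_after n.+1.
Proof.
rewrite -integral_mixed; apply: ge0_le_integral => //.
- by move=> y _; rewrite mule_ge0// lee_fin.
- exact: m_value_before.
- exact: mmixed.
Qed.

Let integral_V_rconst n y :
  \int[mu]_z along chi (V mu hk f lam (n:=n.+1)) (rconst y z) =
  next_cost mu (V mu hk f lam (n:=n.+1)) (controls chi y) y
    (@chi n (controls chi y) y).
Proof.
by apply: eq_integral => z _; rewrite /along controls_rconst.
Qed.

Let m_integral_V n : measurable_fun setT (fun y =>
  \int[mu]_z along chi (V mu hk f lam (n:=n.+1)) (rconst y z)).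
Proof. by apply: measurable_integral_rconst; [exact: V0|exact: mV]. Qed.

Let m_survive_V n : measurable_fun setT (fun y =>
  (along chi (survive psi (n:=n)) y)%:E *
    \int[mu]_z along chi (V mu hk f lam (n:=n.+1)) (rconst y z)).
Proof.
apply: emeasurable_funM; last exact: m_integral_V.
by apply/measurable_EFinP; exact: msurvive.
Qed.

(** Whether stage n + 1 is reached is settled by the first n observations, so that weight leaves the
    inner integral. *)
Let value_beforeS n : value_before n.+1 =
  \int[power_measure mu n]_y
    ((along chi (survive psi (n:=n)) y)%:E *
      \int[mu]_z along chi (V mu hk f lam (n:=n.+1)) (rconst y z)).
Proof.
rewrite /value_before integral_power_measureS; last 2 first.
- by move=> y; rewrite mule_ge0// lee_fin.
- exact: m_value_before.
apply: eq_integral => y _.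
under eq_integral => z _.
  rewrite {1}/along controls_rconst reach_rconst.
  over.
rewrite ge0_integralZl_EFin//; last exact: survive0.
rewrite /along; under eq_fun do rewrite controls_rconst.
by apply: measurable_rconst_section; exact: measurable_V.
Qed.

Let Rn_le_integral n y :
  (along chi (survive psi (n:=n)) y)%:E * along chi (Rn mu hk f lam (n:=n)) y
  <= (along chi (survive psi (n:=n)) y)%:E *
      \int[mu]_z along chi (V mu hk f lam (n:=n.+1)) (rconst y z).
Proof.
rewrite lee_wpmul2l ?lee_fin// integral_V_rconst.
exact: min_control_le_next_cost.
Qed.

Lemma value_after_le n : value_after n <= value_before n.+1.
Proof.
rewrite value_beforeS; apply: ge0_le_integral => //.
- by move=> y _; rewrite mule_ge0// lee_fin.
- exact: m_value_after.
- exact: m_survive_V.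
Qed.

Lemma value_before_eqP n : value_before n.+1 < +oo ->
  value_before n.+1 = stage_cost n.+1 + value_after n.+1 <->
  {ae power_measure mu n.+1, forall y, reach_set chi psi y ->
    (\1_[set y' | (along chi (min_loss f lam (n:=n.+1)) y' <
          (along chi (joint_density f (H1 hk) (n:=n.+1)) y')%:E +
            along chi (Rn mu hk f lam (n:=n.+1)) y')%E] y
       <= along chi (@psi n.+1) y <=
     \1_[set y' | (along chi (min_loss f lam (n:=n.+1)) y' <=
          (along chi (joint_density f (H1 hk) (n:=n.+1)) y')%:E +
            along chi (Rn mu hk f lam (n:=n.+1)) y')%E] y)%R}.
Proof.
move=> vfin; rewrite -integral_mixed.
apply: (iff_trans (ge0_eq_integral_aeP _ _ _ _ _ vfin)) => //.
- exact: m_value_before.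
- exact: mmixed.
- by move=> y; rewrite mule_ge0// lee_fin.
- by move=> y; rewrite fin_numM// V_fin.
have ptw y : (along chi (reach psi (n:=n.+1)) y)%:E *
     along chi (V mu hk f lam (n:=n.+1)) y = mixed y <->
   (reach_set chi psi y ->
    (\1_[set y' | (along chi (min_loss f lam (n:=n.+1)) y' <
          (along chi (joint_density f (H1 hk) (n:=n.+1)) y')%:E +
            along chi (Rn mu hk f lam (n:=n.+1)) y')%E] y
       <= along chi (@psi n.+1) y <=
     \1_[set y' | (along chi (min_loss f lam (n:=n.+1)) y' <=
          (along chi (joint_density f (H1 hk) (n:=n.+1)) y')%:E +
            along chi (Rn mu hk f lam (n:=n.+1)) y')%E] y)%R).
  rewrite V_recE mixedE !indic_setb.
  apply: (iff_trans (mine_eq_convexP _ _ _ _)) => //.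
  by rewrite EFinD !fineK//; [exact: (Rn_fin hf)|exact: min_loss_fin].
by split; apply: filterS => y; apply ptw.
Qed.

(** Where [survive] is 0 both integrands vanish; where it is positive it cancels. This is the origin
    of the set [survive_set] in condition (b). *)
Lemma value_after_eqP n : value_after n < +oo ->
  value_after n = value_before n.+1 <->
  {ae power_measure mu n, forall y, survive_set chi psi y ->
    \int[mu]_z along chi (V mu hk f lam (n:=n.+1)) (rconst y z) =
    along chi (Rn mu hk f lam (n:=n)) y}.
Proof.
move=> vfin; rewrite value_beforeS.
apply: (iff_trans (ge0_eq_integral_aeP _ _ _ _ _ vfin)) => //.
- exact: m_value_after.
- exact: m_survive_V.
- by move=> y; rewrite mule_ge0// lee_fin.
- by move=> y; rewrite fin_numM// (Rn_fin hf).
have ptw y : (along chi (survive psi (n:=n)) y)%:E *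
    along chi (Rn mu hk f lam (n:=n)) y =
  (along chi (survive psi (n:=n)) y)%:E *
      \int[mu]_z along chi (V mu hk f lam (n:=n.+1)) (rconst y z) <->
  (survive_set chi psi y ->
    \int[mu]_z along chi (V mu hk f lam (n:=n.+1)) (rconst y z) =
    along chi (Rn mu hk f lam (n:=n)) y).
  split => [sE sgt0|sE].
    by apply/eqP; rewrite eq_le; apply/andP; split;
      rewrite -(@lee_pmul2l _ (along chi (survive psi (n:=n)) y)%:E)// sE.
  have := survive0 y; rewrite le_eqVlt => /predU1P[<-|/sE ->//].
  by rewrite !mul0e.
by split; apply: filterS => y; apply ptw.
Qed.

End stage_costs.

(** With [u n] = P(tau = n + 1) and [e n] = P(tau > n), this is the tail formula for E tau.
    Telescoping identifies [e m] with the tail sum of [u] from [m]; then the double sum of [v] over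
    the triangle m <= n is taken in both orders, row n having n + 1 entries. *)
Lemma expected_value_tail_sum (R : realType) (u e : nat -> \bar R) :
  (forall n, 0 <= u n) -> (forall n, 0 <= e n) -> (forall n, e n \is a fin_num) ->
  (forall n, e n = u n + e n.+1) -> e n @[n --> \oo] --> 0 ->
  \sum_(0 <= n <oo) n.+1%:R%:E * u n = \sum_(0 <= n <oo) e n.
Proof.
move=> u0 e0 efin eS e_cvg.
have tail m : \sum_(m <= n <oo) u n = e m.
  rewrite -nneseries_addn//.
  pose a n := e (n + m)%N.
  have [] := @telescoping_eqP _ a (fun n => u (n + m)%N) (fun n => e (n + m).+1);
    rewrite /a ?add0n//.
  - by move=> n; rewrite eS.
  - by rewrite (cvg_shiftn m e).
  - by move=> _; apply => n; rewrite /a -eS.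
pose v n m : \bar R := if (m <= n)%N then u n else 0.
have v0 n m : 0 <= v n m by rewrite /v; case: ifP.
transitivity (\sum_(0 <= n <oo) \sum_(0 <= m <oo) v n m).
  apply: eq_eseriesr => n _.
  rewrite (nneseries_split _ n.+1)// add0n [X in _ + X]eseries0 ?adde0; last first.
    by move=> m nm _; rewrite /v leqNgt nm.
  rewrite big_nat_cond (eq_bigr (fun=> u n)); last first.
    by move=> m; rewrite andbT /= ltnS /v => ->.
  rewrite -big_nat_cond sumr_const_nat subn0.
  by rewrite mule_natl.
rewrite nneseries_interchange//; apply: eq_eseriesr => m _.
rewrite (nneseries_split _ m)// add0n big_nat_cond big1 ?add0e; last first.
  by move=> n; rewrite andbT /= ltnNge /v => /negbTE ->.
rewrite -tail -[LHS]nneseries_addn// -[RHS]nneseries_addn//.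
apply: eq_eseriesr => n _.
by rewrite /v leq_addl.
Qed.

(** * Expectations under a policy *)

Section expectations.
Context (R : realType) (dX dY : measure_display).
Context (X : measurableType dX) (Y : measurableType dY).
Context (mu : {sigma_finite_measure set Y -> \bar R}).
Context (k : nat) (f : 'I_k -> X -> Y -> R).
Hypothesis hf : is_density_family mu f.
Variables (chi : policy X Y).
Hypothesis chiP : is_policy chi.

Lemma expect_ge0 i n (F : n.-tuple X -> n.-tuple Y -> R) :
  (forall x y, 0 <= F x y)%R -> 0 <= expect mu f chi i F.
Proof.
move=> F0; apply: integral_ge0 => y _.
by rewrite lee_fin mulr_ge0 ?(joint_density_ge0 hf)//; exact: F0.
Qed.

Lemma measurable_expectand i n (F : n.-tuple X -> n.-tuple Y -> R) :
  jointly_measurable n F ->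
  measurable_fun setT
    (fun y => (along chi F y * along chi (joint_density f i (n:=n)) y)%:E).
Proof.
move=> mF; apply/measurable_EFinP; apply: measurable_funM.
- exact: measurable_along.
- by apply: measurable_along => //; exact: (measurable_joint_density hf).
Qed.

Lemma le_expect i n (F G : n.-tuple X -> n.-tuple Y -> R) :
  (forall x y, 0 <= F x y)%R -> (forall x y, F x y <= G x y)%R ->
  jointly_measurable n F -> jointly_measurable n G ->
  expect mu f chi i F <= expect mu f chi i G.
Proof.
move=> F0 FG mF mG; apply: ge0_le_integral => //.
- move=> y _; rewrite lee_fin mulr_ge0 ?(joint_density_ge0 hf)//; exact: F0.
- exact: measurable_expectand.
- exact: measurable_expectand.
- move=> y _; rewrite lee_fin ler_wpM2r ?(joint_density_ge0 hf)//; exact: FG.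
Qed.

Lemma expectD i n (F G : n.-tuple X -> n.-tuple Y -> R) :
  (forall x y, 0 <= F x y)%R -> (forall x y, 0 <= G x y)%R ->
  jointly_measurable n F -> jointly_measurable n G ->
  expect mu f chi i (fun x y => F x y + G x y)%R =
  expect mu f chi i F + expect mu f chi i G.
Proof.
move=> F0 G0 mF mG; rewrite /expect -ge0_integralD//.
- by apply: eq_integral => y _; rewrite -EFinD -mulrDl.
- move=> y _; rewrite lee_fin mulr_ge0 ?(joint_density_ge0 hf)//; exact: F0.
- exact: measurable_expectand.
- move=> y _; rewrite lee_fin mulr_ge0 ?(joint_density_ge0 hf)//; exact: G0.
- exact: measurable_expectand.
Qed.

(** [accept_loss] mixes the densities of all hypotheses other than [j], so a single integral against
    mu^n collects the expectations under each of them. *)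
Lemma expect_accept_loss (lam : 'I_k -> 'I_k -> R) j n
    (F : n.-tuple X -> n.-tuple Y -> R) :
  (forall i, i != j -> 0 <= lam i j)%R ->
  (forall x y, 0 <= F x y)%R -> jointly_measurable n F ->
  \int[power_measure mu n]_y
    (along chi F y * along chi (accept_loss f lam j (n:=n)) y)%:E =
  \sum_(i < k | i != j) (lam i j)%:E * expect mu f chi i F.
Proof.
move=> lam0 F0 mF.
have FD0 i y : (0 <= along chi F y * along chi (joint_density f i (n:=n)) y)%R.
  by rewrite mulr_ge0 ?(joint_density_ge0 hf)//; exact: F0.
transitivity (\int[power_measure mu n]_y \sum_(i < k | i != j)
    ((lam i j)%:E *
     (along chi F y * along chi (joint_density f i (n:=n)) y)%:E)).
  apply: eq_integral => y _; rewrite {2}/along /accept_loss mulr_sumr -sumEFin.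
  by apply: eq_bigr => i _; rewrite -EFinM mulrCA.
rewrite ge0_integral_sum_cond.
- apply: eq_bigr => i ij; rewrite ge0_integralZl_EFin ?lam0//.
  + by move=> y _; rewrite lee_fin.
  + exact: measurable_expectand.
- by move=> i ij; apply: measurable_funeM; exact: measurable_expectand.
- by move=> i y ij; rewrite mule_ge0 ?lee_fin ?lam0.
Qed.

Section stopping.
Variable psi : stopping R X Y.
Hypothesis psiP : is_stopping psi.

Lemma expect_reach i n : expect mu f chi i (reach psi (n:=n.+1)) =
  expect mu f chi i (survive psi (n:=n)).
Proof.
rewrite /expect -[RHS](integral_marginal hf)//.
- by apply: eq_integral => y _; rewrite {1}/along reachS /= prefixt_rconst ?prefixt_id.
- by move=> y; exact: survive_ge0.
- by apply: measurable_along => //; exact: measurable_survive.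
Qed.

End stopping.

End expectations.

(** * Sample size, error terms and total cost in the class *)

Section procedures.
Context (R : realType) (dX dY : measure_display).
Context (X : measurableType dX) (Y : measurableType dY).
Context (mu : {sigma_finite_measure set Y -> \bar R}).
Context (k : nat) (hk : (1 < k)%N) (f : 'I_k -> X -> Y -> R).
Hypothesis hf : is_density_family mu f.
Variable lam : 'I_k -> 'I_k -> R.
Hypothesis hlam : forall i j, i != j -> (0 < lam i j)%R.
Hypothesis hmin : minima_ok mu hk f lam.
Variables (chi : policy X Y) (psi : stopping R X Y).
Hypothesis chi_psiF : strategy_class mu f chi psi.

Let chiP : is_policy chi. Proof. by have [] := chi_psiF. Qed.
Let psiP : is_stopping psi. Proof. by have [] := chi_psiF. Qed.

Let lam_ge0 i j : i != j -> (0 <= lam i j)%R.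
Proof. by move=> /hlam/ltW. Qed.

Let psi_ge0 n (x : n.+1.-tuple X) (y : n.+1.-tuple Y) : (0 <= @psi n.+1 x y)%R.
Proof. by have [_ /(_ x y)/andP[]] := psiP (ltn0Sn n). Qed.

Let mpsi n : jointly_measurable n.+1 (@psi n.+1).
Proof. by have [] := psiP (ltn0Sn n). Qed.

Let stopw n (x : n.-tuple X) (y : n.-tuple Y) : R :=
  (reach psi x y * psi x y)%R.

Let stopw_ge0 n (x : n.+1.-tuple X) (y : n.+1.-tuple Y) : (0 <= stopw x y)%R.
Proof. by rewrite mulr_ge0// reach_ge0. Qed.

Let mstopw n : jointly_measurable n.+1 (@stopw n.+1).
Proof.
by apply: measurable_funM; [exact: measurable_reach|exact: mpsi].
Qed.

Lemma stop_at_ge0 i n : 0 <= stop_at mu f chi psi i n.+1.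
Proof. by apply: (expect_ge0 hf) => x y; exact: stopw_ge0. Qed.

Lemma expect_survive_rec i n : expect mu f chi i (survive psi (n:=n)) =
  stop_at mu f chi psi i n.+1 + expect mu f chi i (survive psi (n:=n.+1)).
Proof.
rewrite -(expect_reach hf)// -(expectD hf)//.
- congr expect; apply/funext => x; apply/funext => y.
  by rewrite survive_reach -mulrDr addrCA subrr addr0 mulr1.
- by move=> x y; exact: stopw_ge0.
- by move=> x y; exact: survive_ge0.
- exact: measurable_survive.
Qed.

Lemma expect_survive0 i : expect mu f chi i (survive psi (n:=0)) = 1.
Proof.
rewrite /expect /= integral_dirac//.
  by rewrite diracT mul1e /along /survive /joint_density !big_ord0 mulr1.
apply: (measurable_expectand hf) => //; exact: measurable_survive.
Qed.

Let survive_expect_ge0 i n : 0 <= expect mu f chi i (survive psi (n:=n)).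
Proof. by apply: (expect_ge0 hf) => x y; exact: survive_ge0. Qed.

Lemma expect_survive_le1 i n : expect mu f chi i (survive psi (n:=n)) <= 1.
Proof.
elim: n => [|n]; first by rewrite expect_survive0.
by apply: le_trans; rewrite (expect_survive_rec i n) leeDr// stop_at_ge0.
Qed.

Lemma expect_survive_fin i n :
  expect mu f chi i (survive psi (n:=n)) \is a fin_num.
Proof.
by rewrite ge0_fin_numE// (le_lt_trans (expect_survive_le1 i n))// ltry.
Qed.

Let expect_survive_cvg i :
  expect mu f chi i (survive psi (n:=n)) @[n --> \oo] --> 0.
Proof. by have [_ _] := chi_psiF; apply. Qed.

(** In the class the survival probabilities tend to 0, so telescoping them loses no mass. This
    selects the finite-stopping branch of [avg_sample_number]. *)
Lemma sum_stop_at i : \sum_(1 <= n <oo) stop_at mu f chi psi i n = 1.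
Proof.
rewrite eseries_shift1; last by move=> n; exact: stop_at_ge0.
rewrite -(expect_survive0 i).
have rec_le n : expect mu f chi i (survive psi (n:=n)) <=
    stop_at mu f chi psi i n.+1 + expect mu f chi i (survive psi (n:=n.+1)).
  by rewrite -expect_survive_rec.
have [_] := @telescoping_eqP _
  (fun n => expect mu f chi i (survive psi (n:=n)))
  (fun n => stop_at mu f chi psi i n.+1)
  (fun n => expect mu f chi i (survive psi (n:=n.+1)))
  (survive_expect_ge0 i) (stop_at_ge0 i) rec_le
  (fun n => lexx _) (expect_survive_cvg i) (expect_survive_fin i 0).
by apply => n; rewrite -expect_survive_rec.
Qed.

(** The tail formula for the stopping time; its term of index 0 is the survival probability over no
    stages, which is the separate 1. *)
Lemma avg_sample_numberE : avg_sample_number mu hk f chi psi =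
  1 + \sum_(0 <= n <oo) expect mu f chi (H1 hk) (survive psi (n:=n.+1)).
Proof.
rewrite /avg_sample_number sum_stop_at eqxx.
rewrite eseries_shift1; last first.
  by move=> n; rewrite mule_ge0// ?lee_fin ?ler0n// stop_at_ge0.
rewrite (expected_value_tail_sum
  (e := fun n => expect mu f chi (H1 hk) (survive psi (n:=n))))//.
- by rewrite nneseries_recl// expect_survive0 eseries_shift1.
- by move=> n; exact: stop_at_ge0.
- by move=> n; exact: expect_survive_fin.
- by move=> n; exact: expect_survive_rec.
Qed.

Section decision.
Variable phi : decision R X Y k.
Hypothesis phiP : is_decision phi.

Let phi_ge0 n j (x : n.+1.-tuple X) (y : n.+1.-tuple Y) :
  (0 <= @phi n.+1 j x y)%R.
Proof. by have [_ + _] := phiP (ltn0Sn n); apply. Qed.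

Let phi_sum n (x : n.+1.-tuple X) (y : n.+1.-tuple Y) :
  (\sum_(j < k) @phi n.+1 j x y = 1)%R.
Proof. by have [_ _] := phiP (ltn0Sn n); apply. Qed.

Let phi_le1 n j (x : n.+1.-tuple X) (y : n.+1.-tuple Y) :
  (@phi n.+1 j x y <= 1)%R.
Proof.
rewrite -(phi_sum x y) (bigD1 j)//= lerDl; apply: sumr_ge0 => i _.
exact: phi_ge0.
Qed.

Let accw j n (x : n.-tuple X) (y : n.-tuple Y) : R :=
  (reach psi x y * psi x y * phi j x y)%R.

Let accw_ge0 j n (x : n.+1.-tuple X) (y : n.+1.-tuple Y) : (0 <= accw j x y)%R.
Proof. by rewrite mulr_ge0 ?stopw_ge0// phi_ge0. Qed.

Let maccw j n : jointly_measurable n.+1 (@accw j n.+1).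
Proof.
apply: measurable_funM; first exact: mstopw.
by have [+ _ _] := phiP (ltn0Sn n); apply.
Qed.

Let accw_expect_ge0 i j n : 0 <= expect mu f chi i (@accw j n.+1).
Proof. by apply: (expect_ge0 hf) => x y; exact: accw_ge0. Qed.

Lemma alphaE i j : alpha mu f chi psi phi i j =
  \sum_(0 <= n <oo) expect mu f chi i (@accw j n.+1).
Proof. by rewrite /alpha eseries_shift1//; move=> n; exact: accw_expect_ge0. Qed.

Lemma alpha_ge0 i j : 0 <= alpha mu f chi psi phi i j.
Proof. by rewrite alphaE; apply: nneseries_ge0 => n _ _; exact: accw_expect_ge0. Qed.

Lemma alpha_fin i j : alpha mu f chi psi phi i j \is a fin_num.
Proof.
rewrite ge0_fin_numE ?alpha_ge0//; apply: (@le_lt_trans _ _ 1); last exact: ltry.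
rewrite -(sum_stop_at i) eseries_shift1; last by move=> n; exact: stop_at_ge0.
rewrite alphaE; apply: lee_nneseries => n *; first exact: accw_expect_ge0.
apply: (le_expect hf) => //.
by move=> x y; rewrite ler_piMr ?stopw_ge0.
Qed.

Definition weighted_error : \bar R :=
  \sum_(j < k) \sum_(i < k | i != j) (lam i j)%:E * alpha mu f chi psi phi i j.

Lemma weighted_error_fin : weighted_error \is a fin_num.
Proof.
have finD (x y : \bar R) : x \is a fin_num -> y \is a fin_num ->
    x + y \is a fin_num by rewrite fin_numD => -> ->.
apply: (big_ind (fun x => x \is a fin_num)) => // j _.
apply: (big_ind (fun x => x \is a fin_num)) => // i _.
by rewrite fin_numM// alpha_fin.
Qed.

Let error_integrand n y :=
  \sum_(j < k) (along chi (@accw j n) y *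
    along chi (accept_loss f lam j (n:=n)) y)%:E.

Let accept0 j n (x : n.-tuple X) (y : n.-tuple Y) :
  (0 <= accept_loss f lam j x y)%R.
Proof. exact: (accept_loss_ge0 hf). Qed.

Let m_error_term j n : measurable_fun setT (fun y =>
  (along chi (@accw j n.+1) y *
    along chi (accept_loss f lam j (n:=n.+1)) y)%:E).
Proof.
apply/measurable_EFinP; apply: measurable_funM.
- by apply: measurable_along => //; exact: maccw.
- by apply: measurable_along => //; exact: (measurable_accept_loss hf).
Qed.

Lemma weighted_errorE : weighted_error =
  \sum_(0 <= n <oo) \int[power_measure mu n.+1]_y @error_integrand n.+1 y.
Proof.
transitivity (\sum_(0 <= n <oo) \sum_(j < k) \sum_(i < k | i != j)
    (lam i j)%:E * expect mu f chi i (@accw j n.+1)).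
  have t0 i j n : i != j ->
      0 <= (lam i j)%:E * expect mu f chi i (@accw j n.+1).
    by move=> ij; rewrite mule_ge0// lee_fin lam_ge0.
  rewrite nneseries_sum; last by move=> j n _; apply: sume_ge0 => i; exact: t0.
  apply: eq_bigr => j _; rewrite nneseries_sum; last by move=> i n; exact: t0.
  apply: eq_bigr => i ij; rewrite nneseriesZl; last first.
    by move=> n _; exact: accw_expect_ge0.
  by rewrite alphaE.
apply: eq_eseriesr => n _; rewrite /error_integrand ge0_integral_sum//.
- apply: eq_bigr => j _; rewrite (expect_accept_loss hf)//.
  + by move=> i; exact: lam_ge0.
- by move=> j; exact: m_error_term.
- by move=> j y _; rewrite lee_fin mulr_ge0//; [exact: accw_ge0|exact: accept0].
Qed.

(** The acceptance probabilities sum to 1, so the error integrand is a convex combination of the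
    losses [accept_loss], none of which is below their minimum. *)
Let loss_le_integrand n (y : n.+1.-tuple Y) :
  (along chi (reach psi (n:=n.+1)) y * along chi (@psi n.+1) y)%:E *
     along chi (min_loss f lam (n:=n.+1)) y <= error_integrand y.
Proof.
have [j0 j0E] := min_loss_attained hk f lam (controls chi y) y.
rewrite {3}/along j0E -EFinM /error_integrand sumEFin lee_fin.
rewrite -[leLHS]mulr1 -(phi_sum (controls chi y) y) mulr_sumr.
apply: ler_sum => j _; rewrite mulrAC; apply: ler_wpM2l.
  exact: accw_ge0.
by rewrite -lee_fin -j0E min_loss_le.
Qed.

Lemma sum_stop_loss_le_weighted_error :
  \sum_(0 <= n <oo) stop_loss mu f lam chi psi n.+1 <= weighted_error.
Proof.
rewrite weighted_errorE; apply: lee_nneseries => n *.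
  exact: (stop_loss_ge0 hk hf).
apply: ge0_le_integral => //.
- move=> y _; rewrite mule_ge0 ?lee_fin//; first exact: stopw_ge0.
  exact: (min_loss_ge0 hk hf).
- apply: emeasurable_funM; last first.
    by apply: measurable_along => //; exact: (measurable_min_loss hf).
  apply/measurable_EFinP.
  by apply: (measurable_along (F := @stopw n.+1)) => //; exact: mstopw.
- by apply: emeasurable_sum => j; exact: m_error_term.
Qed.

Lemma weighted_error_minimizing : minimizing_decision f lam phi ->
  weighted_error = \sum_(0 <= n <oo) stop_loss mu f lam chi psi n.+1.
Proof.
move=> phi_min; rewrite weighted_errorE; apply: eq_eseriesr => n _.
apply: eq_integral => y _.
have [j0 j0E] := min_loss_attained hk f lam (controls chi y) y.
rewrite [in RHS]/along j0E -EFinM /error_integrand sumEFin; congr EFin.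
rewrite -[RHS]mulr1 -(phi_sum (controls chi y) y) mulr_sumr.
apply: eq_bigr => j _; rewrite mulrAC.
have := phi_min n.+1 isT j (controls chi y) y; rewrite indicE.
(* Either [j] attains the minimal loss and the two terms agree, or the indicator is 0 and forces the
   acceptance probability of [j] to vanish. *)
case: (boolP (_ \in _)) => [|_].
  by rewrite inE /= j0E => -[<-] _; rewrite /along /accw mulrAC.
rewrite mulr0n => phi0.
have phi0E : phi j (controls chi y) y = 0%R.
  by apply/eqP; rewrite eq_le phi0 phi_ge0.
by rewrite /along /accw phi0E !(mulr0, mul0r).
Qed.

End decision.

(** V is bounded by the loss of stopping at once and accepting [H1 hk]. That loss involves only the
    other hypotheses, so membership in the class under each of them drives the bound to 0. *)
Lemma value_before_le_expect n :
  value_before mu hk f lam chi psi n.+1 <=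
  \sum_(i < k | i != H1 hk)
    (lam i (H1 hk))%:E * expect mu f chi i (survive psi (n:=n)).
Proof.
under eq_bigr do rewrite -(expect_reach hf)//.
rewrite -(expect_accept_loss hf)//; last 3 first.
- by move=> i; exact: lam_ge0.
- by move=> x y; exact: reach_ge0.
- exact: measurable_reach.
apply: ge0_le_integral => //.
- move=> y _; rewrite mule_ge0 ?lee_fin//; first exact: reach_ge0.
  exact: V_ge0.
- apply: emeasurable_funM; last first.
    by apply: measurable_along => //; exact: measurable_V.
  by apply/measurable_EFinP; apply: measurable_along => //; exact: measurable_reach.
- apply/measurable_EFinP; apply: measurable_funM.
    by apply: measurable_along => //; exact: measurable_reach.
  by apply: measurable_along => //; exact: (measurable_accept_loss hf).
- move=> y _; rewrite EFinM lee_wpmul2l ?lee_fin//; first exact: reach_ge0.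
  apply: (le_trans (V_le_min_loss hf hlam hmin _ _)).
  exact: min_loss_le.
Qed.

Lemma value_before_lty n : value_before mu hk f lam chi psi n.+1 < +oo.
Proof.
apply: le_lt_trans (value_before_le_expect n) _; apply: lte_sum_pinfty => i _.
by rewrite ltey_eq fin_numM// expect_survive_fin.
Qed.

Lemma value_before_cvg0 :
  value_before mu hk f lam chi psi n.+1 @[n --> \oo] --> 0.
Proof.
apply: (@squeeze_cvge _ _ _ _ (cst 0) _ (fun n =>
   \sum_(i < k | i != H1 hk)
    (lam i (H1 hk))%:E * expect mu f chi i (survive psi (n:=n)))).
- apply: nearW => n; rewrite value_before_le_expect andbT.
  exact: value_before_ge0.
- exact: cvg_cst.
pose g i n := (lam i (H1 hk))%:E * expect mu f chi i (survive psi (n:=n)).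
have g_cvg i : i != H1 hk -> g i n @[n --> \oo] --> 0.
  move=> ij; rewrite /g -[X in _ --> X](mule0 (lam i (H1 hk))%:E).
  exact: cvgeZl.
have g0 i : i != H1 hk -> \forall n \near \oo, 0 <= g i n.
  by move=> ij; apply: nearW => n; rewrite mule_ge0 ?lee_fin ?lam_ge0.
have := @cvg_nnesum _ \oo eventually_filter R _ (index_enum 'I_k) g (fun=> 0) _ g0 g_cvg.
by rewrite big1.
Qed.

Let R0 := Rn mu hk f lam [tuple] [tuple] : \bar R.

Let value_before1 : value_before mu hk f lam chi psi 1 =
  \int[mu]_z along chi (V mu hk f lam (n:=1)) [tuple z].
Proof.
rewrite /value_before integral_power_measure1.
- apply: eq_integral => z _.
  by rewrite {1}/along /reach big_mkcond big_ord_recl big_ord0 /= mulr1 mul1e.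
- move=> y; rewrite mule_ge0 ?lee_fin//; first exact: reach_ge0.
  exact: V_ge0.
- apply: emeasurable_funM; last first.
    by apply: measurable_along => //; exact: measurable_V.
  by apply/measurable_EFinP; apply: measurable_along => //; exact: measurable_reach.
Qed.

Let R0_le : R0 <= value_before mu hk f lam chi psi 1.
Proof.
rewrite value_before1.
have -> : \int[mu]_z along chi (V mu hk f lam (n:=1)) [tuple z] =
    next_cost mu (V mu hk f lam (n:=1)) [tuple] [tuple] (@chi 0%N [tuple] [tuple]).
  apply: eq_integral => z _.
  have -> : [tuple z] = rconst [tuple] z :> 1.-tuple Y by exact/val_inj.
  by rewrite /along controls_rconst.
exact: min_control_le_next_cost.
Qed.

Let S := \sum_(0 <= n <oo) stage_cost mu hk f lam chi psi n.+1.

Let value_after_lty n : value_after mu hk f lam chi psi n.+1 < +oo.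
Proof.
apply: le_lt_trans (value_before_lty n.+1).
exact: (value_after_le hf hlam hmin chiP psiP).
Qed.

Lemma Rn0_le_total_cost : R0 <= S.
Proof.
apply: (le_trans R0_le); apply: (telescoping_le
  (a := fun n => value_before mu hk f lam chi psi n.+1)
  (r := fun n => value_after mu hk f lam chi psi n.+1)).
- by move=> n; exact: stage_cost_ge0.
- by move=> n; exact: value_before_le.
- by move=> n; exact: value_after_le.
- exact: value_before_cvg0.
Qed.

(** In R_0 <= a_1 <= S the outer terms agree exactly when both inequalities are equalities. The
    first is (c); the second, by telescoping, is (a) and (b) at all stages. *)
Lemma total_cost_optimalP :
  S = R0 <-> optimal_conditions mu hk f lam chi psi.
Proof.
have before_fin : value_before mu hk f lam chi psi 1 \is a fin_num.
  by rewrite ge0_fin_numE ?value_before_lty//; exact: value_before_ge0.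
have [tele1 tele2] := @telescoping_eqP _
  (fun n => value_before mu hk f lam chi psi n.+1)
  (fun n => stage_cost mu hk f lam chi psi n.+1)
  (fun n => value_after mu hk f lam chi psi n.+1)
  (fun n => value_before_ge0 hf hlam hmin chi psiP n)
  (fun n => stage_cost_ge0 hk hf hlam chi psiP n)
  (fun n => value_before_le hf hlam hmin chiP psiP n)
  (fun n => value_after_le hf hlam hmin chiP psiP n.+1)
  value_before_cvg0 before_fin.
split => [SR0|[ca cb cc]].
  have before1 : value_before mu hk f lam chi psi 1 = R0.
    apply/eqP; rewrite eq_le R0_le andbT -SR0.
    apply: (telescoping_le (r := fun n => value_after mu hk f lam chi psi n.+1)
      (a := fun n => value_before mu hk f lam chi psi n.+1)).
    - by move=> n; exact: stage_cost_ge0.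
    - by move=> n; exact: value_before_le.
    - by move=> n; exact: value_after_le.
    - exact: value_before_cvg0.
  have /tele1 tele : S = value_before mu hk f lam chi psi 1 by rewrite before1.
  split.
  - move=> [//|n] _; have [beforeE _] := tele n.
    exact: (value_before_eqP hf hlam hmin chiP psiP (value_before_lty n)).1.
  - move=> [//|n] _; have [_ afterE] := tele n.
    exact: (value_after_eqP hf hlam hmin chiP psiP (value_after_lty n)).1.
  - by rewrite /cond_c -value_before1.
rewrite /R0 -cc -value_before1; apply: tele2 => n; split.
- apply: (value_before_eqP hf hlam hmin chiP psiP (value_before_lty n)).2.
  exact: ca.
- apply: (value_after_eqP hf hlam hmin chiP psiP (value_after_lty n)).2.
  exact: cb.
Qed.

Lemma total_costE : S = \sum_(0 <= n <oo) stop_loss mu f lam chi psi n.+1 +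
  \sum_(0 <= n <oo) expect mu f chi (H1 hk) (survive psi (n:=n.+1)).
Proof.
rewrite -nneseriesD//.
by move=> n *; exact: (stop_loss_ge0 hk hf).
Qed.

End procedures.

(** * The Bayes risk and its minimum 1 + R_0 *)

Section bayes_risk.
Context (R : realType) (dX dY : measure_display).
Context (X : measurableType dX) (Y : measurableType dY).
Context (mu : {sigma_finite_measure set Y -> \bar R}).
Context (k : nat) (hk : (1 < k)%N) (f : 'I_k -> X -> Y -> R).
Hypothesis hf : is_density_family mu f.
Variable lam : 'I_k -> 'I_k -> R.
Hypothesis hlam : forall i j, i != j -> (0 < lam i j)%R.
Hypothesis hmin : minima_ok mu hk f lam.
Variables (chi : policy X Y) (psi : stopping R X Y) (phi : decision R X Y k).
Hypotheses (chi_psiF : strategy_class mu f chi psi) (phiP : is_decision phi).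

Definition bayes_risk : \bar R :=
  avg_sample_number mu hk f chi psi + weighted_error mu f lam chi psi phi.

Let R0 := Rn mu hk f lam [tuple] [tuple] : \bar R.

Lemma bayes_risk_ge_total_cost :
  1 + \sum_(0 <= n <oo) stage_cost mu hk f lam chi psi n.+1 <= bayes_risk.
Proof.
rewrite /bayes_risk (avg_sample_numberE hk hf chi_psiF) -addeA leeD2l//.
rewrite (total_costE hk hf hlam chi_psiF) [leLHS]addeC leeD2l//.
exact: sum_stop_loss_le_weighted_error.
Qed.

Lemma bayes_risk_ge : 1 + R0 <= bayes_risk.
Proof.
apply: le_trans bayes_risk_ge_total_cost; rewrite leeD2l//.
exact: Rn0_le_total_cost.
Qed.

Lemma bayes_risk_optimal : optimal_conditions mu hk f lam chi psi ->
  minimizing_decision f lam phi -> bayes_risk = 1 + R0.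
Proof.
move=> opt phi_min.
rewrite -[R0]((total_cost_optimalP hf hlam hmin chi_psiF).2 opt).
rewrite /bayes_risk (avg_sample_numberE hk hf chi_psiF) -addeA.
rewrite (weighted_error_minimizing hk hf hlam chi_psiF)//.
by rewrite (total_costE hk hf hlam chi_psiF) [in RHS](addeC (\sum_(_ <= _ <oo) _)).
Qed.

(** The total cost is squeezed between R_0 and the risk less 1, so minimal risk forces minimal total
    cost. *)
Lemma bayes_risk_attained : bayes_risk = 1 + R0 ->
  optimal_conditions mu hk f lam chi psi.
Proof.
move=> riskE; apply/(total_cost_optimalP hf hlam hmin chi_psiF).
apply/eqP; rewrite eq_le Rn0_le_total_cost// andbT.
by rewrite -(@leeD2lE _ 1)// -/R0 -riskE bayes_risk_ge_total_cost.
Qed.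

End bayes_risk.

Section weighted_error_comparison.
Context (R : realType) (dX dY : measure_display).
Context (X : measurableType dX) (Y : measurableType dY).
Context (mu : {sigma_finite_measure set Y -> \bar R}).
Context (k : nat) (f : 'I_k -> X -> Y -> R).
Hypothesis hf : is_density_family mu f.
Variable lam : 'I_k -> 'I_k -> R.
Hypothesis hlam : forall i j, i != j -> (0 < lam i j)%R.
Variables (chi chi' : policy X Y) (psi psi' : stopping R X Y).
Variables (phi phi' : decision R X Y k).
Hypothesis chi_psiF' : strategy_class mu f chi' psi'.
Hypothesis phiP' : is_decision phi'.
Hypothesis alpha_le : forall i j, i != j ->
  alpha mu f chi' psi' phi' i j <= alpha mu f chi psi phi i j.

Let term_le i j : i != j ->
  (lam i j)%:E * alpha mu f chi' psi' phi' i j <=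
  (lam i j)%:E * alpha mu f chi psi phi i j.
Proof.
move=> ij; apply: lee_wpmul2l; last exact: alpha_le.
by rewrite lee_fin ltW// hlam.
Qed.

Lemma weighted_error_le :
  weighted_error mu f lam chi' psi' phi' <= weighted_error mu f lam chi psi phi.
Proof. by apply: lee_sum => j _; apply: lee_sum => i; exact: term_le. Qed.

Lemma weighted_error_lt i j : i != j ->
  alpha mu f chi' psi' phi' i j < alpha mu f chi psi phi i j ->
  weighted_error mu f lam chi' psi' phi' < weighted_error mu f lam chi psi phi.
Proof.
(* The smaller sum is finite, so a strict inequality in one term survives the addition of the other
   terms in [\bar R]. *)
move=> ij alt; have := weighted_error_fin hf lam chi_psiF' phiP'.
rewrite /weighted_error (bigD1 j)//= (bigD1 i)//= !fin_numD.
move=> /andP[/andP[tfin rfin] sfin].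
rewrite [ltRHS](bigD1 j)//= [X in _ < X + _](bigD1 i)//=.
apply: lte_leD => //; last first.
  by apply: lee_sum => j' _; apply: lee_sum => i'; exact: term_le.
apply: lte_leD => //; last by apply: lee_sum => i' /andP[? _]; exact: term_le.
by rewrite lte_pmul2l ?lte_fin ?hlam.
Qed.

End weighted_error_comparison.

Theorem theorem8 (R : realType) (dX dY : measure_display)
    (X : measurableType dX) (Y : measurableType dY)
    (mu : {sigma_finite_measure set Y -> \bar R})
    (k : nat) (hk : (1 < k)%N)
    (f : 'I_k -> X -> Y -> R) (hf : is_density_family mu f)
    (lam : 'I_k -> 'I_k -> R)
    (hlam : forall i j, i != j -> (0 < lam i j)%R)
    (hmin : minima_ok mu hk f lam)
    (chi : policy X Y) (psi : stopping R X Y)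
    (hF : strategy_class mu f chi psi)
    (hopt : optimal_conditions mu hk f lam chi psi)
    (phi : decision R X Y k) (hphi : is_decision phi)
    (hphi_min : minimizing_decision f lam phi)
    (chi' : policy X Y) (psi' : stopping R X Y) (phi' : decision R X Y k)
    (hF' : strategy_class mu f chi' psi') (hphi' : is_decision phi')
    (hle : forall i j, i != j ->
       alpha mu f chi' psi' phi' i j <= alpha mu f chi psi phi i j) :
  [/\ avg_sample_number mu hk f chi psi <= avg_sample_number mu hk f chi' psi',
      (exists i j, i != j /\
         alpha mu f chi' psi' phi' i j < alpha mu f chi psi phi i j) ->
      avg_sample_number mu hk f chi psi < avg_sample_number mu hk f chi' psi' &
      (forall i j, i != j ->
         alpha mu f chi' psi' phi' i j = alpha mu f chi psi phi i j) ->
      avg_sample_number mu hk f chi' psi' = avg_sample_number mu hk f chi psi ->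
      optimal_conditions mu hk f lam chi' psi'].
Proof.
have R0fin : Rn mu hk f lam [tuple] [tuple] \is a fin_num.
  exact: (Rn_fin hf hlam hmin).
have riskE := bayes_risk_optimal hf hlam hmin hF hphi hopt hphi_min.
have risk_le : bayes_risk mu hk f lam chi psi phi <=
    bayes_risk mu hk f lam chi' psi' phi'.
  by rewrite riskE; exact: bayes_risk_ge.
have Wfin := weighted_error_fin hf lam hF hphi.
have W'fin := weighted_error_fin hf lam hF' hphi'.
(* The risk of the given procedure is 1 + R_0, which is finite, and this forces its average sample
   number to be finite. *)
have Nfin : avg_sample_number mu hk f chi psi \is a fin_num.
  have : bayes_risk mu hk f lam chi psi phi \is a fin_num.
    by rewrite riskE fin_numD R0fin.
  by rewrite fin_numD => /andP[].
have NN' : avg_sample_number mu hk f chi psi <= avg_sample_number mu hk f chi' psi'.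
  rewrite -(leeD2rE _ _ Wfin); apply: (le_trans risk_le).
  by rewrite leeD2l// weighted_error_le.
split => //.
(* If N' did not exceed N it would equal it; being finite, it would leave the risk of the competitor
   strictly below the minimum. *)
- move=> [i [j [ij alt]]]; rewrite ltNge; apply/negP => N'N.
  have N'E : avg_sample_number mu hk f chi' psi' = avg_sample_number mu hk f chi psi.
    by apply/eqP; rewrite eq_le N'N.
  move: risk_le; rewrite leNgt => /negP; apply.
  rewrite /bayes_risk N'E; apply: lee_ltD => //.
  exact: (weighted_error_lt hf hlam hF' hphi' hle ij).
- move=> alphaE NE; apply: (bayes_risk_attained hf hlam hmin hF' hphi').
  rewrite -riskE /bayes_risk NE; congr (_ + _).
  by apply: eq_bigr => j _; apply: eq_bigr => i ij; rewrite alphaE.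
Qed.
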